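(* Let $\kappa,\tau,\delta$ be infinite cardinals. The following are equivalent: (1) $\kappa\leq\tau\leq\mathbf{d}(\kappa)$ and $\delta\geq\mathbf{b}_\kappa(\tau)$. (2) There exists a Banach space $X$ such that $\ell K(X)=\kappa$, $CG(X)=\tau$ and $dens(X)=\delta$.
   Context: For topological spaces $\Sigma$ and $Z$, with $2^Z$ the family of all subsets of $Z$, a map $\phi:\Sigma\to 2^Z$ is an usco if: (i) $\phi(\sigma)$ is a compact subset of $Z$ for every $\sigma\in\Sigma$; (ii) for every open $U\subset Z$ the set $\{\sigma\in\Sigma:\phi(\sigma)\subseteq U\}$ is open in $\Sigma$; (iii) $\bigcup_{\sigma\in\Sigma}\phi(\sigma)=Z$. For a topological space $Z$, the index of $\mathcal{K}$-analyticity $\ell K(Z)$ is the least infinite cardinal $\kappa$ for which there exist a complete metric space $M$ of weight $\kappa$ and an usco $M\to 2^Z$; the index of compact generation $CG(Z)$ is the least infinite cardinal $\kappa$ such that there exists a family $\{K_\lambda:\lambda<\kappa\}$ of compact subsets of $Z$ whose union is dense in $Z$. For a Banach space $X$, $\ell K(X)$ and $CG(X)$ are always computed with respect to the weak topology of $X$. $dens(X)$ denotes the density character of $X$ (the least cardinality of a norm-dense subset). A cardinal $\kappa$ is regarded as a discrete topological space of cardinality $\kappa$, and $\kappa^\omega$ is the space of sequences of elements of $\kappa$ with the product topology. The cardinal $\mathbf{d}(\kappa)$ is the least cardinal $\lambda$ such that $\kappa^\omega$ is the union of $\lambda$ many compact subsets. For a cardinal $\tau\leq\mathbf{d}(\kappa)$,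 $\mathbf{b}_\kappa(\tau)$ is the least cardinal $\lambda$ for which there exists a set $A\subset\kappa^\omega$ of cardinality $\lambda$ such that $A$ is not contained in any union of less than $\tau$ many compact subsets of $\kappa^\omega$. *)

(* Defs.v *)
From HB Require Import structures.
From mathcomp Require Import all_boot all_order all_algebra.
From mathcomp Require Import all_classical all_reals all_analysis.

Set Implicit Arguments.
Unset Strict Implicit.
Unset Printing Implicit Defensive.

Import Order.TTheory GRing.Theory Num.Theory.
Import numFieldNormedType.Exports.

Local Open Scope classical_set_scope.
Local Open Scope ring_scope.
Local Open Scope card_scope.

(** Following the relational treatment of cardinals in [cardinality.v], a
    cardinal is represented by a type having that cardinality. Hence a
    cardinal invariant is a predicate [inv x L], read "the value of the
    invariant at [x] is the cardinality of [L]"; it determines [L] up to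
    bijection. *)
Definition is_least_cardinal (P : Type -> Prop) (L : Type) : Prop :=
  P L /\ forall L' : Type, P L' -> [set: L] #<= [set: L'].

Definition card_lt T U (A : set T) (B : set U) : Prop :=
  A #<= B /\ ~ (B #<= A).

Definition is_weight (Z : topologicalType) : Type -> Prop :=
  is_least_cardinal (fun L =>
    exists2 B : set (set Z), basis B & B #= [set: L]).

Definition is_density (Z : topologicalType) : Type -> Prop :=
  is_least_cardinal (fun L =>
    exists2 S : set Z, dense S & S #= [set: L]).

#[short(type="completeMetricType")]
HB.structure Definition CompleteMetric (K : numDomainType) :=
  { M of Metric K M & Complete M }.

Definition usco (S Z : topologicalType) (phi : S -> set Z) : Prop :=
  [/\ forall s, compact (phi s),
      forall U : set Z, open U -> open [set s | phi s `<=` U]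
    & \bigcup_s phi s = [set: Z]].

(** The real field [R] only serves as the codomain of the metrics. *)
Definition is_lK (R : realType) (Z : topologicalType) : Type -> Prop :=
  is_least_cardinal (fun L => infinite_set [set: L] /\
    exists M : completeMetricType R,
      is_weight M L /\ exists phi : M -> set Z, usco phi).

Definition is_CG (Z : topologicalType) : Type -> Prop :=
  is_least_cardinal (fun L => infinite_set [set: L] /\
    exists C : L -> set Z,
      (forall l, compact (C l)) /\ dense (\bigcup_l C l)).

(** The carrier of [X] with its weak topology, that is, the coarsest topology
    making every norm-continuous linear functional continuous. *)
Definition weak_space (R : realType) (X : normedModType R) : topologicalType :=
  sup_topology (fun f : {f : {linear X -> R^o} | continuous f} =>
    Topological.class (initial_topology (sval f : X -> R^o))).

(** [{classic K}] endows an arbitrary type with the choice structure that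
    topological spaces are required to have. *)
Definition omega_power (K : Type) : topologicalType :=
  {ptws nat -> discrete_topology {classic K}}.

Definition is_d (K : Type) : Type -> Prop :=
  is_least_cardinal (fun L =>
    exists C : L -> set (omega_power K),
      (forall l, compact (C l)) /\ \bigcup_l C l = [set: omega_power K]).

Definition is_b (K T : Type) : Type -> Prop :=
  is_least_cardinal (fun L =>
    exists2 A : set (omega_power K), A #= [set: L] &
      forall (I : Type) (C : I -> set (omega_power K)),
        card_lt [set: I] [set: T] -> (forall i, compact (C i)) ->
        ~ (A `<=` \bigcup_i C i)).

(* Main.v *)
Require Import Defs.
From HB Require Import structures.
From mathcomp Require Import all_boot all_order all_algebra.
From mathcomp Require Import all_classical all_reals all_analysis.
From mathcomp Require Import ring lra.

(** The argument rests on one reformulation.  For a map [phi] from a sequence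
    space to the subsets of [Z], [seq_usco phi] says: if a pair [(s, z)] runs
    through the graph of [phi] along an ultrafilter and every coordinate of [s]
    is eventually that of [s0], then [z] converges to a point of [phi s0].
    This expresses compact values and upper semicontinuity at once, and it is
    visibly stable under sums, multiplication by a bounded set of scalars,
    reindexing, and passing from maps [phi n] to the set of points that are
    within [1 / (n + 1)] of [phi n s] for all [n] ([seq_usco_approx]).  A complete
    metric space of weight [K] is an usco image of [K^omega], by closed balls
    around the points of a dense set ([metric_usco_seq]), and [K^omega] is itself
    such a space ([seq_usco_metric]); so the index of K-analyticity of [Z] is at
    most [K] exactly when some [seq_usco] defined on [K^omega] covers [Z].

    From a Banach space [X] to the cardinal inequalities.  If weakly compact
    sets [C t], [t] in [tau], have weakly dense union, then, by Mazur's theorem,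
    every point of [X] is a norm limit of linear combinations of points of the
    [C t], and recording the approximations as a sequence over [tau] makes [X] an
    usco image of [tau^omega] ([seq_usco_generate]); hence [kappa <= tau].  An
    usco image of a compact set is compact, so a compact cover of [kappa^omega]
    induces a weakly compact cover of [X], and [tau <= d(kappa)].  Finally choose,
    for every [x] in a norm dense set of size [delta], a sequence whose value
    contains [x]: fewer than [tau] compact sets covering these sequences would
    yield fewer than [tau] weakly compact sets with dense union, so
    [b_kappa(tau) <= delta].

    From the inequalities to a Banach space.  Let [A] be a subset of
    [kappa^omega], of size [b_kappa(tau)], that fewer than [tau] compact sets
    cannot cover.  Give each [a] in [delta] a column [c a] in [tau] and a
    sequence [g a] in [kappa^omega], so that all pairs in [tau * A] occur.  A
    subset of [delta] is [n]-dispersed when its elements have distinct columns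
    and distinct [n]-th coordinates.  The space is the closed span, among the
    bounded functions of pairs [(n, D)], of the vectors [e_ a] taking the value
    [1 / (n + 1)] at [(n, D)] when [D] is [n]-dispersed and contains [a], and the
    value [0] otherwise: up to a constant, the norm is the supremum of weighted
    l1 norms over dispersed sets.  An [n]-dispersed set meets a column, and
    meets a set of indices with the same [n]-th coordinate, in at most one point; hence the unit vectors of a column, or along a convergent net of
    sequences, are weakly null ([functional_small]).  This makes each column
    together with [0] weakly compact, so [tau] compact sets suffice, and makes
    [s |-> 0 and the e_ a with g a = s] an usco, so [kappa] suffices for
    K-analyticity.
    In the other direction the space behaves like l1 on a dispersed set.  By a
    gliding hump, as in Schur's theorem, a weakly compact set has only finitely
    many large coordinates on such a set ([compact_no_dispersed_sequence]).  If
    fewer than [tau] weakly compact sets had dense union, [delta] would split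
    into fewer than [tau] pieces containing no infinite dispersed set.  But in
    each column one of the pieces takes infinitely many values at some
    coordinate [n], by the choice of [A]; the same piece and the same [n] serve
    for infinitely many columns; and picking one point in each of these columns,
    with distinct [n]-th coordinates, produces an infinite dispersed set in that
    piece.  Likewise [kappa] dispersed points force the weight of the metric
    space to be at least [kappa] ([usco_weight_ge]), and the unit vectors are at
    mutual distance at least [1], which makes the density [delta]. *)

Set Implicit Arguments.
Unset Strict Implicit.
Unset Printing Implicit Defensive.

Import Order.TTheory GRing.Theory Num.Theory.
Import numFieldNormedType.Exports.

Local Open Scope classical_set_scope.
Local Open Scope ring_scope.
Local Open Scope card_scope.

(** * Comparison and arithmetic of cardinals *)

Lemma card_leTTP T U :
  [set: T] #<= [set: U] <-> exists f : T -> U, injective f.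
Proof.
split=> [/card_leP[f]|[f fI]].
  exists (fun x => val (f (SigSub (mem_setT x)))) => x y /val_inj.
  by move=> /(inj (mem_set (I : setT _)) (mem_set (I : setT _))) [].
have /injfunPex[f'] : exists2 f : T -> U, set_fun setT setT f & set_inj setT f.
  by exists f => // x y _ _; exact: fI.
exact: inj_card_le f'.
Qed.

Lemma card_le_rel T U (r : T -> U -> Prop) : (forall t, exists u, r t u) ->
  (forall t t' u, r t u -> r t' u -> t = t') -> [set: T] #<= [set: U].
Proof.
move=> /choice[f rf] rI; apply/card_leTTP; exists f => t t' e.
by apply: (rI t t' (f t')) => //; rewrite -e.
Qed.

Lemma card_le_setP T U (u0 : U) (A : set T) (B : set U) : A #<= B <->
  exists f : T -> U, (forall x, A x -> B (f x)) /\
    (forall x y, A x -> A y -> f x = f y -> x = y).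
Proof.
split=> [/card_leP[f]|[f [fB fI]]].
  exists (fun x => if pselect (A x) is left Ax then val (f (SigSub (mem_set Ax)))
                 else u0); split=> [x Ax|x y Ax Ay].
    by case: pselect => // ?; apply: set_valP.
  case: pselect => // Ax'; case: pselect => // Ay' /val_inj.
  by move=> /(inj (mem_set (I : setT _)) (mem_set (I : setT _))) [].
have /injfunPex[f'] : exists2 f : T -> U, set_fun A B f & set_inj A f.
  by exists f => // x y /set_mem Ax /set_mem Ay; exact: fI.
exact: inj_card_le f'.
Qed.

(** A maximal set of points of the product on which every projection is
    injective must project onto some factor [X i], and then embeds [X i] into
    each [X j].  This gives both the existence of least cardinals and the
    comparability of any two cardinals. *)
Lemma least_card_family (I : Type) (i0 : I) (X : I -> Type) :
  exists i, forall j, [set: X i] #<= [set: X j].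
Proof.
apply: contrapT => /forallNP noleast.
pose P (Y : set (forall i, X i)) :=
  forall i y z, Y y -> Y z -> y i = z i -> y = z.
have [F FP Ftot|Y [PY Ymax]] := @Zorn_bigcup _ P.
  move=> i y z [A FA Ay] [B FB Bz].
  by have [AB|BA] := Ftot _ _ FA FB;
    [apply: FP FB _ _ _ (AB _ Ay) Bz|apply: FP FA _ _ _ Ay (BA _ Bz)].
have freshP : forall i, exists x, forall z, Y z -> z i <> x.
  move=> i; apply: contrapT => /forallNP H; apply: (noleast i) => j.
  apply: (@card_le_rel _ _ (fun t u => exists2 y, Y y & y i = t /\ y j = u)).
    move=> t; have /existsNP[z] := H t.
    by move=> /not_implyP[Yz /contrapT zt]; exists (z j), z.
  by move=> t t' u [y Yy [<- <-]] [z Yz [<- /esym/(PY _ _ _ Yy Yz) ->]].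
pose y i := sval (cid (freshP i)).
have yP i : forall z, Y z -> z i <> y i by exact: (svalP (cid (freshP i))).
apply: (Ymax (y |` Y)); first split.
- by move=> ?; right.
- by move=> /(_ y (or_introl erefl)) Yy; exact: (yP i0 y Yy).
- move=> i u v [->|Yu] [->|Yv] //; last exact: PY.
    by move=> e; case: (yP i v Yv).
  by move=> e; case: (yP i u Yu).
Qed.

Lemma card_le_or T U : [set: T] #<= [set: U] \/ [set: U] #<= [set: T].
Proof.
have [[] H] := @least_card_family bool true (fun b => if b then T else U).
  by left; apply: (H false).
by right; apply: (H true).
Qed.

Lemma least_cardinalP (P : Type -> Prop) (L0 : Type) : P L0 ->
  exists L, is_least_cardinal P L.
Proof.
move=> PL0; pose Fam := {A : set L0 | exists L, P L /\
  [set: L] #<= [set: {x | A x}] /\ [set: {x | A x}] #<= [set: L]}.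
have inI (L : Type) : P L -> [set: L] #<= [set: L0] ->
    exists i : Fam, [set: {x | sval i x}] #<= [set: L].
  move=> PL /card_leTTP[f fI].
  have AL : [set: {x | range f x}] #<= [set: L].
    apply: (@card_le_rel _ _ (fun t u => f u = sval t)).
      move=> [x xP]; suff [y fyx] : exists y, f y = x by exists y.
      by case: xP => y _ <-; exists y.
    by move=> [t ?] [t' ?] u /= ut ut'; apply: eq_exist; rewrite -ut.
  suff Arange : exists L, P L /\ [set: L] #<= [set: {x | range f x}] /\
      [set: {x | range f x}] #<= [set: L] by exists (exist _ (range f) Arange).
  exists L; split=> //; split=> //; apply/card_leTTP.
  by exists (fun y => exist _ (f y) (imageP f I)) => y z [] /fI.
have [i0 _] := inI L0 PL0 (card_lexx _).
have [m mmin] := least_card_family i0 (fun i => {x | sval i x}).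
have [L [PL [LA _]]] := svalP m.
exists L; split=> // L' PL'; apply: card_le_trans LA _.
have [L'L0|L0L'] := card_le_or L' L0.
  have [i iL'] := inI _ PL' L'L0.
  exact: card_le_trans (mmin i) iL'.
have [i iL0] := inI _ PL0 (card_lexx _).
exact: card_le_trans (mmin i) (card_le_trans iL0 L0L').
Qed.

(** An infinite [T] satisfies [T * T <= T]: take a maximal partial pairing
    function, that is, an injection [D * D -> D] with [D] a subset of [T].
    If the complement of [D] were as large as [D], a copy of [D] inside it would
    have room for the three new blocks of the square; otherwise [T <= D], and the
    pairing transfers to [T]. *)
Section infinite_square.
Variables (T : Type) (Tinf : infinite_set [set: T]).

(* partial pairings are handled through their graphs, so that Zorn's lemma for
   set inclusion applies *)
Let dom (G : set (T * T * T)) : set T := [set x | exists z, G (x, x, z)].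

Let pairing (G : set (T * T * T)) :=
  [/\ forall x y z, G (x, y, z) -> [/\ dom G x, dom G y & dom G z],
      forall x y, dom G x -> dom G y -> exists z, G (x, y, z),
      forall x y z z', G (x, y, z) -> G (x, y, z') -> z = z' &
      forall x y x' y' z, G (x, y, z) -> G (x', y', z) -> x = x' /\ y = y'].

Let pairing_fun G : pairing G -> exists h : T -> T -> T,
  [/\ forall x y, dom G x -> dom G y -> G (x, y, h x y),
      forall x y, dom G x -> dom G y -> dom G (h x y) &
      forall x y x' y', dom G x -> dom G y -> dom G x' -> dom G y' ->
        h x y = h x' y' -> x = x' /\ y = y'].
Proof.
case=> Gdom Gtot Gfun Ginj.
have /choice[h hP] : forall p : T * T, exists z,
    dom G p.1 -> dom G p.2 -> G (p.1, p.2, z).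
  move=> [x y] /=; case: (pselect (dom G x /\ dom G y)) => [[Dx Dy]|nD].
    by have [z Gz] := Gtot _ _ Dx Dy; exists z.
  by exists x => Dx Dy; case: nD.
have hG x y : dom G x -> dom G y -> G (x, y, h (x, y)).
  by move=> Dx Dy; exact: (hP (x, y)).
exists (fun x y => h (x, y)); split=> //.
- by move=> x y Dx Dy; have [] := Gdom _ _ _ (hG _ _ Dx Dy).
- move=> x y x' y' Dx Dy Dx' Dy' e.
  by apply: (Ginj _ _ _ _ _ (hG _ _ Dx Dy)); rewrite e; exact: hG.
Qed.

Let pairing_bigcup (F : set (set (T * T * T))) : F `<=` pairing ->
  total_on F subset -> pairing (\bigcup_(G in F) G).
Proof.
move=> FP Ftot.
have Fdom G x : F G -> dom G x -> dom (\bigcup_(G in F) G) x.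
  by move=> FG [z Gz]; exists z, G.
have Fdir A B : F A -> F B -> exists2 G, F G & A `<=` G /\ B `<=` G.
  move=> FA FB; have [AB|BA] := Ftot _ _ FA FB.
    by exists B; last split.
  by exists A; last split.
split.
- move=> x y z [G FG Gxyz]; have [Gdom _ _ _] := FP _ FG.
  by have [] := Gdom _ _ _ Gxyz; split; exact: (Fdom G).
- move=> x y [z [A FA Az]] [z' [B FB Bz']].
  have [G FG [AG BG]] := Fdir _ _ FA FB.
  have [_ Gtot _ _] := FP _ FG.
  have [||w Gw] := Gtot x y; first by exists z; exact: AG.
    by exists z'; exact: BG.
  by exists w, G.
- move=> x y z z' [A FA Az] [B FB Bz].
  have [G FG [AG BG]] := Fdir _ _ FA FB.
  by have [_ _ Gfun _] := FP _ FG; apply: Gfun (AG _ Az) (BG _ Bz).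
- move=> x y x' y' z [A FA Az] [B FB Bz].
  have [G FG [AG BG]] := Fdir _ _ FA FB.
  by have [_ _ _ Ginj] := FP _ FG; apply: Ginj (AG _ Az) (BG _ Bz).
Qed.

Let pairing_extend G (e : nat -> T) : pairing G -> injective e ->
  (forall n, dom G (e n)) -> dom G #<= ~` dom G ->
  exists2 G', pairing G' & G `<` G'.
Proof.
move=> GP eI eD /(card_le_setP (e 0%N))[j [jD jI]].
have [h [hG hD hI]] := pairing_fun GP.
have [Gdom Gtot Gfun Ginj] := GP.
(* the new domain is [dom G] (b = false) with a disjoint copy (b = true) *)
pose s (b : bool) x := if b then j x else x.
have sI b c x y : dom G x -> dom G y -> s b x = s c y -> b = c /\ x = y.
  move=> Dx Dy; case: b; case: c => //= E.
  - by split=> //; exact: jI.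
  - by have := jD _ Dx; rewrite E => /(_ Dy).
  - by have := jD _ Dy; rewrite -E => /(_ Dx).
pose num (b c : bool) := (b + c.*2)%N.
have numI b c b' c' : num b c = num b' c' -> b = b' /\ c = c'.
  by case: b b' c c' => -[] [] [].
pose pre b c x y := h (e (num b c)) (h x y).
have preD b c x y : dom G x -> dom G y -> dom G (pre b c x y).
  by move=> Dx Dy; apply: (hD) => //; exact: hD.
have preI b c x y b' c' x' y' : dom G x -> dom G y -> dom G x' -> dom G y' ->
    pre b c x y = pre b' c' x' y' -> [/\ b = b', c = c', x = x' & y = y'].
  move=> Dx Dy Dx' Dy'.
  case/(hI _ _ _ _ (eD _) (hD _ _ Dx Dy) (eD _) (hD _ _ Dx' Dy')).
  by move=> /eI/numI[-> ->] /(hI _ _ _ _ Dx Dy Dx' Dy')[-> ->].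
(* the three new blocks of the square, sent into the copy *)
pose N := [set t : T * T * T | exists b c x y, [/\ b || c, dom G x, dom G y &
   t = (s b x, s c y, j (pre b c x y))]].
have Ddom b x : dom G x -> dom (G `|` N) (s b x).
  case: b => Dx /=; last by have [z Gz] := Dx; exists z; left.
  by exists (j (pre true true x x)); right; exists true, true, x, x.
have domD x : dom (G `|` N) x -> exists b y, dom G y /\ x = s b y.
  case=> z [/Gdom[Dx _ _]|[b [c [y [y' [bc Dy Dy' [-> _ _]]]]]]].
    by exists false, x.
  by exists b, y.
exists (G `|` N); last first.
  split; first by left.
  pose z := j (pre true true (e 0%N) (e 0%N)).
  move=> /(_ (s true (e 0%N), s true (e 0%N), z)) GN.
  have /GN/Gdom[/(jD _ (eD 0%N))//] : (G `|` N) (s true (e 0%N), s true (e 0%N), z).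
  by right; exists true, true, (e 0%N), (e 0%N).
split.
- move=> x y z [/Gdom[Dx Dy Dz]|[b [c [x' [y' [bc Dx Dy [-> -> ->]]]]]]].
    by split; exact: (Ddom false).
  by split; [exact: Ddom|exact: Ddom|apply: (Ddom true); exact: preD].
- move=> x y /domD[b [x' [Dx ->]]] /domD[c [y' [Dy ->]]].
  case bc : (b || c).
    by exists (j (pre b c x' y')); right; exists b, c, x', y'.
  have [-> ->] : b = false /\ c = false by case: b c bc => -[].
  by exists (h x' y'); left; exact: hG.
- move=> x y z z' [Gz|[b [c [x1 [y1 [bc Dx1 Dy1 [xE yE ->]]]]]]]
    [Gz'|[b' [c' [x2 [y2 [bc' Dx2 Dy2 [xE' yE' ->]]]]]]].
  + exact: Gfun Gz Gz'.
  + have [Dx Dy _] := Gdom _ _ _ Gz; subst x y; case: b' c' bc' Dx Dy {Gz} => -[] //= _.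
    * by move=> /(jD _ Dx2).
    * by move=> /(jD _ Dx2).
    * by move=> _ /(jD _ Dy2).
  + have [Dx Dy _] := Gdom _ _ _ Gz'; subst x y; case: b c bc Dx Dy {Gz'} => -[] //= _.
    * by move=> /(jD _ Dx1).
    * by move=> /(jD _ Dx1).
    * by move=> _ /(jD _ Dy1).
  + rewrite xE in xE'; rewrite yE in yE'.
    have [-> ->] := sI _ _ _ _ Dx1 Dx2 xE'.
    by have [-> ->] := sI _ _ _ _ Dy1 Dy2 yE'.
- move=> x y x' y' z [Gz|[b [c [x1 [y1 [bc Dx1 Dy1 [-> -> zE]]]]]]]
    [Gz'|[b' [c' [x2 [y2 [bc' Dx2 Dy2 [-> -> zE']]]]]]].
  + exact: Ginj Gz Gz'.
  + by have [_ _] := Gdom _ _ _ Gz; rewrite zE' => /(jD _ (preD _ _ _ _ _ _))[].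
  + by have [_ _] := Gdom _ _ _ Gz'; rewrite zE => /(jD _ (preD _ _ _ _ _ _))[].
  + move: zE; rewrite zE'.
    move=> /(jI _ _ (preD _ _ _ _ Dx2 Dy2) (preD _ _ _ _ Dx1 Dy1)).
    by move=> /(preI _ _ _ _ _ _ _ _ Dx2 Dy2 Dx1 Dy1)[-> -> -> ->].
Qed.

Lemma card_prod_le : [set: T * T] #<= [set: T].
Proof.
have /card_leTTP[e eI] := (infiniteP _).1 Tinf.
have [h0 h0I] : exists h : nat * nat -> nat, injective h.
  by exists pickle; exact: (pcan_inj pickleK).
(* starting from a pairing on an infinite set keeps the maximal domain
   infinite *)
pose G0 := [set t : T * T * T | exists m n, t = (e m, e n, e (h0 (m, n)))].
have domG0 n : dom G0 (e n) by exists (e (h0 (n, n))), n, n.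
have G0P : pairing G0.
  split.
  - by move=> x y z [m [n [-> -> ->]]].
  - move=> x y [_ [m [_ [-> _ _]]]] [_ [n [_ [-> _ _]]]].
    by exists (e (h0 (m, n))), m, n.
  - move=> x y z z' [m [n [-> -> ->]]] [m' [n' [/eI -> /eI ->]]] //.
  - move=> x y x' y' z [m [n [-> -> ->]]] [m' [n' [-> ->]]].
    by move=> /eI/h0I[-> ->].
have [F FP Ftot|G [GP Gmax]] := @Zorn_bigcup _ [set G | pairing (G `|` G0)].
  have [->|/set0P[A FA]] := eqVneq F set0.
    by rewrite bigcup_set0 /= set0U.
  rewrite /= -bigcupUl; last by exists A.
  rewrite (_ : \bigcup_(i in F) _ = \bigcup_(G in [set i `|` G0 | i in F]) G).
    apply: pairing_bigcup; first by move=> _ [B FB <-]; exact: FP.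
    move=> _ _ [B FB <-] [C FC <-].
    by have [BC|CB] := Ftot _ _ FB FC; [left|right]; exact: setSU.
  by rewrite bigcup_image.
set H := G `|` G0 in GP.
have eD n : dom H (e n) by have [z zP] := domG0 n; exists z; right.
have [h [hG hD hI]] := pairing_fun GP.
have [TD|DT] := card_le_or {x | dom H x} {x | ~ dom H x}.
  have DD : dom H #<= ~` dom H.
    apply/(card_le_setP (e 0%N)); have /card_leTTP[j jI] := TD.
    exists (fun x => if pselect (dom H x) is left Dx then sval (j (exist _ x Dx))
                     else x); split=> [x Dx|x y Dx Dy].
      by case: pselect => // ?; exact: svalP.
    case: pselect => // Dx'; case: pselect => // Dy' jxy.
    by have /jI[] := @eq_sig_hprop _ _ (fun _ => @Prop_irrelevance _) _ _ jxy.
  have [G' G'P [HG' G'H]] := pairing_extend GP eI eD DD.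
  case: (Gmax G'); last by rewrite /= setUidl// => x G0x; apply: HG'; right.
  split; first by move=> x Gx; apply: HG'; left.
  by move=> G'G; apply: G'H => x /G'G; left.
have [j jI] : exists j : T -> T, injective j /\ forall x, dom H (j x).
  have /card_leTTP[k kI] := DT.
  exists (fun x => match pselect (dom H x) with
    left _ => h (e 0%N) x
    | right nD => h (e 1%N) (sval (k (exist _ x nD))) end); split; last first.
    move=> x; case: pselect => [Dx|nD]; first exact: hD.
    by apply: hD => //; exact: svalP.
  move=> x y; case: pselect => Dx; case: pselect => Dy.
  - by case/hI.
  - by case/hI => //; [exact: svalP|move/eI].
  - by case/hI => //; [exact: svalP|move/eI].
  - case/hI => //; [exact: svalP|exact: svalP|move=> _ kxy].
    by have /kI[] := @eq_sig_hprop _ _ (fun _ => @Prop_irrelevance _) _ _ kxy.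
case: jI => jI jD.
apply/card_leTTP; exists (fun p => h (j p.1) (j p.2)) => -[x y] [x' y'] /=.
by case/hI => // /jI -> /jI ->.
Qed.

End infinite_square.

Lemma card_prod_le2 A B T : infinite_set [set: T] ->
  [set: A] #<= [set: T] -> [set: B] #<= [set: T] -> [set: A * B] #<= [set: T].
Proof.
move=> Tinf /card_leTTP[f fI] /card_leTTP[g gI].
have /card_leTTP[h hI] := card_prod_le Tinf.
apply/card_leTTP; exists (fun p => h (f p.1, g p.2)) => -[a b] [a' b'] /=.
by move=> /hI[] /fI -> /gI ->.
Qed.

Lemma card_nat_le T : infinite_set [set: T] -> [set: nat] #<= [set: T].
Proof. by move/infiniteP. Qed.

Lemma card_countType_le (A : countType) T : infinite_set [set: T] ->
  [set: A] #<= [set: T].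
Proof. by move/card_nat_le; apply: card_le_trans; exact: countableP. Qed.

Lemma card_seq_le A T : infinite_set [set: T] ->
  [set: A] #<= [set: T] -> [set: seq A] #<= [set: T].
Proof.
move=> Tinf AT; have /card_leTTP[h hI] := card_prod_le2 Tinf AT (card_lexx _).
have [t0 _] := infinite_setN0 Tinf.
apply: card_le_trans (card_prod_le2 Tinf (card_nat_le Tinf) (card_lexx _)).
apply/card_leTTP.
exists (fun s => (size s, foldr (fun a t => h (a, t)) t0 s)).
elim=> [|a s IH] [|b r] //= [sz] /hI[->] E.
by rewrite (IH r) // sz E.
Qed.

Lemma card_sum_le A B T : infinite_set [set: T] ->
  [set: A] #<= [set: T] -> [set: B] #<= [set: T] -> [set: A + B] #<= [set: T].
Proof.
move=> Tinf /card_leTTP[f fI] /card_leTTP[g gI].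
have BT : [set: bool] #<= [set: T] := card_countType_le _ Tinf.
apply: card_le_trans (card_prod_le2 Tinf BT (card_lexx _)); apply/card_leTTP.
exists (fun s => match s with inl a => (true, f a) | inr b => (false, g b) end).
by move=> [a|b] [a'|b'] // [] => [/fI|/gI] ->.
Qed.

Lemma card_le_finite_cover B T (J : B -> set T) : infinite_set [set: B] ->
  (forall b, finite_set (J b)) -> (forall t, exists b, J b t) ->
  [set: T] #<= [set: B].
Proof.
move=> Binf Jfin Jcov.
apply: card_le_trans (card_prod_le2 Binf (card_lexx _) (card_nat_le Binf)).
have code b : exists f : T -> nat, {in J b &, injective f}.
  exact/countable_injP/finite_set_countable.
pose f b := sval (cid (code b)).
apply: (@card_le_rel _ _ (fun t p => J p.1 t /\ f p.1 t = p.2)) => [t|t t' [b n]].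
  by have [b Jbt] := Jcov t; exists (b, f b t).
move=> /= [Jt <-] [Jt' /esym]; apply: (svalP (cid (code b))); exact/mem_set.
Qed.

Lemma card_lt_not_le T U :
  ~ ([set: T] #<= [set: U]) -> card_lt [set: U] [set: T].
Proof. by move=> TU; split=> //; have [] := card_le_or T U. Qed.

Lemma card_le_infinite T U : infinite_set [set: T] -> [set: T] #<= [set: U] ->
  infinite_set [set: U].
Proof. by move=> Tinf /card_le_finite H /H. Qed.

(** * Hahn-Banach and the weak topology *)

Section hahn_banach.
Variables (R : realType) (V : lmodType R).
Implicit Types (p q : V -> R).

(** Homogeneity is only required as an inequality; the converse inequality
    follows, and infima of families preserve this form directly. *)
Definition sublinear p :=
  (forall x y, p (x + y) <= p x + p y) /\
  (forall (a : R) x, 0 <= a -> p (a *: x) <= a * p x).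

Lemma sublinear0 p : sublinear p -> p 0 = 0.
Proof.
case=> pD pZ; apply/eqP; rewrite eq_le; apply/andP; split.
  by have := pZ 0 0 (lexx _); rewrite scale0r mul0r.
by have := pD 0 0; rewrite addr0 lerDl.
Qed.

Lemma sublinear_ge p x : sublinear p -> - p (- x) <= p x.
Proof.
move=> sp; rewrite lerNl -subr_ge0 opprK addrC.
by have := sp.1 x (- x); rewrite subrr (sublinear0 sp).
Qed.

(** Common source of the three sublinear functionals used below: the infimum
    of a chain, the shift [inf_t (q (x + t y) - t q y)], and the distance to a
    subspace. *)
Lemma inf_sublinear (I : Type) (A : set I) (F : I -> V -> R) : A !=set0 ->
    (forall x, exists m, forall i, A i -> m <= F i x) ->
    (forall i j x y, A i -> A j ->
       exists2 k, A k & F k (x + y) <= F i x + F j y) ->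
    (forall i (a : R) x, A i -> 0 <= a ->
       exists2 k, A k & F k (a *: x) <= a * F i x) ->
  let q x := inf [set F i x | i in A] in
  [/\ sublinear q, forall i x, A i -> q x <= F i x &
      forall x m, (forall i, A i -> m <= F i x) -> m <= q x].
Proof.
move=> [i0 Ai0] Flb FD FZ q.
have qF i x : A i -> q x <= F i x.
  move=> Ai; apply: ge_inf; last by exists i.
  by have [m mF] := Flb x; exists m => _ [j Aj <-]; exact: mF.
have leq x m : (forall i, A i -> m <= F i x) -> m <= q x.
  by move=> mF; apply: lb_le_inf => [|_ [j Aj <-]]; [exists (F i0 x), i0|exact: mF].
split=> //; split=> [x y|a x a0].
  rewrite -lerBlDr; apply: (leq x (q (x + y) - q y)) => i Ai.
  rewrite lerBlDl -lerBlDr.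
  apply: (leq y (q (x + y) - F i x)) => j Aj; rewrite lerBlDl.
  have [k Ak kij] := FD _ _ x y Ai Aj.
  exact: le_trans (qF _ _ Ak) kij.
move: a0; rewrite le_eqVlt => /predU1P[<-|a0].
  have [k Ak] := FZ i0 0 x Ai0 (lexx _); rewrite !mul0r; apply: le_trans.
  exact: qF.
rewrite -ler_pdivrMl//; apply: (leq x (a^-1 * q (a *: x))) => i Ai.
rewrite ler_pdivrMl//.
by have [k Ak] := FZ i a x Ai (ltW a0); apply: le_trans; exact: qF.
Qed.

Lemma sublinear_homo q a x : sublinear q -> 0 < a -> q (a *: x) = a * q x.
Proof.
move=> sq a0; apply/eqP; rewrite eq_le sq.2 ?(ltW a0)//= -ler_pdivlMl//.
have := sq.2 a^-1 (a *: x); rewrite scalerA mulVf ?gt_eqF// scale1r; apply.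
by rewrite invr_ge0 ltW.
Qed.

(** The shifted functional satisfies [q' x <= q (x + y) - q y].  If [q] is
    minimal then [q' = q], and the inequality makes [q] additive. *)
Lemma sublinear_shift q y : sublinear q -> exists q', [/\ sublinear q',
  forall x, q' x <= q x & forall x, q' x <= q (x + y) - q y].
Proof.
move=> sq; have [qD qZ] := sq.
pose F t x := q (x + t *: y) - t * q y.
have [||||] := @inf_sublinear R [set t | 0 <= t] F.
- by exists 0 => /=.
- move=> x; exists (- q (- x)) => t /= t0; rewrite /F lerBrDr addrC lerBlDr.
  apply: le_trans (_ : q (t *: y) <= _); last first.
    by have := qD (x + t *: y) (- x); rewrite addrAC subrr add0r.
  move: t0; rewrite le_eqVlt => /predU1P[<-|t0].
    by rewrite mul0r scale0r (sublinear0 sq).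
  by rewrite sublinear_homo.
- move=> t s x x' /= t0 s0; exists (t + s); first exact: addr_ge0.
  rewrite /F addrACA -opprD -mulrDl lerD2r scalerDl addrACA; exact: qD.
- move=> t a x /= t0 a0; exists (a * t); first exact: mulr_ge0.
  rewrite /F mulrBr mulrA lerD2r -scalerA -scalerDr; exact: qZ.
move=> sq' q'F _; eexists; split; first exact: sq'.
- move=> x; apply: le_trans (q'F 0 x (lexx _)) _.
  by rewrite /F scale0r addr0 mul0r subr0.
- move=> x; apply: le_trans (q'F 1 x ler01) _.
  by rewrite /F scale1r mul1r.
Qed.

Lemma sublinear_minimal p : sublinear p -> exists q, [/\ sublinear q,
  forall x, q x <= p x &
  forall q', sublinear q' -> (forall x, q' x <= q x) -> q' = q].
Proof.
move=> sp.
pose T := {q | sublinear q /\ forall x, q x <= p x}.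
pose Q (s t : T) := `[< forall x, sval t x <= sval s x >].
have [|||A Atot|[q [sq qp]] qmax] := @Zorn T Q.
- by move=> s; apply/asboolP.
- move=> a b c /asboolP ab /asboolP bc; apply/asboolP => x.
  exact: le_trans (bc x) (ab x).
- move=> [a Pa] [b Pb] /asboolP ab /asboolP ba; apply: eq_exist.
  by apply/funext => x; apply/eqP; rewrite eq_le ab ba.
- have [->|A0] := eqVneq A set0.
    have pT : sublinear p /\ forall x, p x <= p x by [].
    by exists (exist _ p pT).
  have [||||] := @inf_sublinear T A sval; first exact/set0P.
  + move=> x; exists (- p (- x)) => -[q [sq qp]] _ /=.
    by apply: le_trans (sublinear_ge x sq); rewrite lerN2.
  + move=> i j x y Ai Aj; have [/asboolP ij|/asboolP ji] := Atot _ _ Ai Aj.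
      exists j => //; apply: le_trans ((svalP j).1.1 x y) _.
      by rewrite lerD2r.
    exists i => //; apply: le_trans ((svalP i).1.1 x y) _.
    by rewrite lerD2l.
  + by move=> i a x Ai a0; exists i => //; exact: (svalP i).1.2.
  move=> sq qA _; move/set0P : A0 => [i0 Ai0].
  have qp x : inf [set sval i x | i in A] <= p x.
    exact: le_trans (qA _ x Ai0) ((svalP i0).2 x).
  pose m : T := exist _ _ (conj sq qp).
  exists m => i Ai; apply/asboolP => x /=.
  exact: qA.
exists q; split=> // q' sq' q'q.
have q'p x : q' x <= p x by exact: le_trans (q'q x) (qp x).
pose m : T := exist _ q' (conj sq' q'p).
have /qmax[] // : Q (exist _ q (conj sq qp)) m by apply/asboolP.
Qed.

(** A minimal sublinear functional is linear.  Starting from the shift of [p]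
    along [y] forces the value [p y] at [y]. *)
Theorem hahn_banach p y : sublinear p -> exists f : {linear V -> R^o},
  (forall x, f x <= p x) /\ f y = p y.
Proof.
move=> sp; have [p' [sp' p'p p'y]] := sublinear_shift y sp.
have [q [sq qp' qmin]] := sublinear_minimal sp'.
have qD x z : q (x + z) = q x + q z.
  apply/eqP; rewrite eq_le sq.1 /= -lerBrDr.
  have [q' [sq' q'q q'z]] := sublinear_shift z sq.
  by rewrite -{1}(qmin _ sq' q'q).
have q0 : q 0 = 0 := sublinear0 sq.
have qN x : q (- x) = - q x.
  by apply/eqP; rewrite -subr_eq0 opprK -qD addNr q0.
have qZ a x : q (a *: x) = a * q x.
  have [a0|a0|->] := ltgtP a 0; last by rewrite scale0r mul0r.
    by rewrite -{1}[a]opprK scaleNr qN sublinear_homo ?oppr_gt0// mulNr opprK.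
  exact: sublinear_homo.
have qlin : linear (q : V -> R^o) by move=> a x z; rewrite qD qZ.
pose f : {linear V -> R^o} := HB.pack (q : V -> R^o) (GRing.isLinear.Build _ _ _ _ _ qlin).
exists f; split; first by move=> x; exact: le_trans (qp' x) (p'p x).
apply/eqP; rewrite eq_le (le_trans (qp' y) (p'p y))//=.
rewrite -lerN2 -qN; apply: le_trans (qp' _) _.
by apply: le_trans (p'y _) _; rewrite addNr (sublinear0 sp) add0r.
Qed.

End hahn_banach.

Section norming_functionals.
Variables (R : realType) (X : normedModType R).

Lemma dominated_continuous (f : {linear X -> R^o}) (C : R) :
  (forall x, f x <= C * `|x|) -> continuous f.
Proof.
move=> fC; apply/linear_bounded_continuous/linear_boundedP.
exists C; split; first exact: num_real.
move=> M CM x; apply: (@le_trans _ _ (C * `|x|)); last first.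
  by rewrite ler_wpM2r// ltW.
rewrite ler_norml fC andbT lerNl -linearN.
by apply: le_trans (fC _) _; rewrite normrN.
Qed.

Lemma continuous_dominated (f : {linear X -> R^o}) : continuous f ->
  exists2 C : R, 0 < C & forall x, `|f x| <= C * `|x|.
Proof.
move=> /linear_bounded_continuous/linear_boundedP[C [_ fC]].
exists (Num.max 1 (C + 1)); first by rewrite lt_max ltr01.
by apply: fC; rewrite lt_max ltrDl ltr01 orbT.
Qed.

Lemma sublinear_norm : sublinear (fun x : X => `|x|).
Proof.
split=> [x y|a x a0]; first exact: ler_normD.
by rewrite normrZ ger0_norm.
Qed.

Lemma norming_functional (x : X) : exists f : {linear X -> R^o},
  [/\ continuous f, forall y, `|f y| <= `|y| & f x = `|x|].
Proof.
have [f [fle fx]] := hahn_banach x sublinear_norm.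
exists f; split=> // [|y]; first by apply: (@dominated_continuous _ 1) => y; rewrite mul1r.
by rewrite ler_norml fle andbT lerNl -linearN (le_trans (fle _))// normrN.
Qed.

(** The Hahn-Banach theorem applied to the distance to the subspace [D]. *)
Lemma separating_functional (D : set X) (x : X) (e : R) : 0 < e -> D 0 ->
    (forall y z, D y -> D z -> D (y + z)) ->
    (forall a y, D y -> D (a *: y)) ->
    (forall y, D y -> e <= `|x - y|) ->
  exists f : {linear X -> R^o}, [/\ continuous f, 0 < f x &
    forall y, D y -> f y = 0].
Proof.
move=> e0 D0 DD DZ far.
have [||||sp ple pge] := @inf_sublinear R X X D (fun d y => `|y - d|).
- by exists 0.
- by move=> y; exists 0 => d _.
- move=> c d y z Dc Dd; exists (c + d); first exact: DD.
  by rewrite opprD addrACA ler_normD.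
- move=> d a y Dd a0; exists (a *: d); first exact: DZ.
  by rewrite -scalerBr normrZ ger0_norm.
have [f [fle fx]] := hahn_banach x sp.
have fnorm y : f y <= `|y|.
  by apply: le_trans (fle y) _; have := ple 0 y D0; rewrite subr0.
exists f; split.
- by apply: (@dominated_continuous _ 1) => y; rewrite mul1r.
- by rewrite fx; apply: lt_le_trans e0 _; exact: pge.
- have f0 y : D y -> f y <= 0.
    by move=> Dy; apply: le_trans (fle y) _; have := ple y y Dy; rewrite subrr normr0.
  move=> y Dy; apply/eqP; rewrite eq_le f0//= -oppr_le0 -linearN f0//.
  by rewrite -scaleN1r; exact: DZ.
Qed.

End norming_functionals.

Section weak_topology.
Variables (R : realType) (X : normedModType R).
Local Notation W := (weak_space X).

Lemma weak_cvgP (F : set_system W) (x : W) : Filter F ->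
  F --> x <-> forall f : {linear X -> R^o}, continuous f ->
    forall e, 0 < e -> F [set y : X | `|f x - f y| < e].
Proof.
move=> FF; split=> [Fx f fc e e0|Ff].
  have := (@cvg_sup X _ _ F x FF).1 Fx (exist _ f fc).
  move=> /(_ [set y : X | `|f x - f y| < e]); apply.
  rewrite nbhsE; exists [set y : X | `|f x - f y| < e]; last by [].
  split; last by rewrite /= subrr normr0.
  by exists (ball (f x) e) => //; exact: ball_open.
apply/(@cvg_sup X _ _ F x FF) => -[f fc] A /=.
rewrite (@nbhsE (initial_topology (f : X -> R^o))) => -[B [[C Cop <-] Cfx] BA].
apply: filterS BA _.
have /nbhs_ballP[e e0 eC] : nbhs (f x) C by exact: open_nbhs_nbhs.
by apply: filterS (Ff f fc e e0) => y /= fe; exact: eC.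
Qed.

Lemma weak_nbhs (f : {linear X -> R^o}) (x : W) (e : R) : continuous f ->
  0 < e -> nbhs x [set y : W | `|f x - f y| < e].
Proof. by move=> fc e0; apply: (weak_cvgP x _).1. Qed.

Lemma weak_open (f : {linear X -> R^o}) (A : set R) : continuous f -> open A ->
  open (f @^-1` A : set W).
Proof.
move=> fc Aop; rewrite openE => x /= Afx.
have /nbhs_ballP[e e0 eA] : nbhs (f x) A by exact: open_nbhs_nbhs.
by apply: filterS (weak_nbhs x fc e0) => y /= fe; exact: eA.
Qed.

(** Mazur's theorem for linear spans: the weak closure of a subspace is its
    norm closure. *)
Lemma weak_dense_cball (D : set W) (S : set X) (x : X) e : dense D ->
  D `<=` S -> S 0 -> (forall y z, S y -> S z -> S (y + z)) ->
  (forall (a : R) y, S y -> S (a *: y)) -> 0 < e ->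
  exists2 y, S y & `|x - y| < e.
Proof.
move=> Dd DS S0 SD SZ e0; apply: contrapT => nS.
have far y : S y -> e <= `|x - y|.
  by move=> Sy; rewrite leNgt; apply/negP => xy; apply: nS; exists y.
have [f [fc fx fS]] := separating_functional e0 S0 SD SZ far.
have [|y [/= fy /DS/fS]] := Dd _ _ (weak_open fc (@open_gt R 0)).
  by exists x.
by move: fy => /[swap] ->; rewrite ltxx.
Qed.

(** Closed balls are weakly closed. *)
Lemma weak_limit_norm_le (F : set_system W) (x : W) (C : R) :
  ProperFilter F -> F --> x -> F [set y : X | `|y| <= C] -> `|x : X| <= C.
Proof.
move=> FF Fx FC; have [f [fc fle fx]] := norming_functional (x : X).
apply/ler_addgt0Pr => e e0; rewrite -fx.
have FFF : Filter F by exact: FF.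
have Fe := (weak_cvgP x FFF).1 Fx f fc e e0.
have [y [/= fe yC]] := @filter_ex _ F FF _ (@filterI _ F FFF _ _ Fe FC).
rewrite -lerBlDl; apply: le_trans (ltW (le_lt_trans (ler_norm _) fe)).
by rewrite lerB// (le_trans (ler_norm _))// (le_trans (fle y)).
Qed.

End weak_topology.

(** * Uscos on sequence spaces *)

Lemma ultra_fmap (T U : Type) (f : T -> U) (F : set_system T) :
  UltraFilter F -> UltraFilter (f @ F).
Proof.
move=> FU; split=> [|G GP fFG]; first exact: fmap_proper_filter.
apply/seteqP; split=> // A GA; apply: contrapT => nFA.
have [//|FnA] := in_ultra_setVsetC (f @^-1` A) FU.
have /fFG GnA : (f @ F) (~` A) by [].
by have [x []] := @filter_ex _ G GP _ (@filterI _ G _ _ _ GA GnA).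
Qed.

Section omega_power.
Variable K : Type.

Lemma omega_power_nbhs (s : omega_power K) n :
  nbhs s [set t : omega_power K | t n = s n].
Proof.
pose Kn (n : nat) : topologicalType := discrete_topology {classic K}.
have := @proj_continuous nat Kn n s [set a | a = s n].
by apply; apply/principal_filterP.
Qed.

Lemma omega_power_compact (F : nat -> set K) : (forall n, finite_set (F n)) ->
  compact [set s : omega_power K | forall n, F n (s n)].
Proof.
move=> Ffin.
apply: (@tychonoff nat (fun=> discrete_topology {classic K}) F) => n.
exact: finite_compact.
Qed.

(** If infinitely many values occurred at coordinate [n], the sets omitting only
    finitely many of them would generate a proper filter on [C] without cluster
    point. *)
Lemma compact_coord_finite (C : set (omega_power K)) n : compact C ->
  finite_set [set s n | s in C].
Proof.
move=> Cco; apply: contrapT => Cinf.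
pose F := [set A : set (omega_power K) | finite_set [set s n | s in C `\` A]].
have FP : ProperFilter F.
  apply: Build_ProperFilter_ex.
    move=> A FA; apply: contrapT => A0; apply: Cinf.
    apply: sub_finite_set FA => _ [s Cs <-]; exists s => //; split=> // As.
    by apply: A0; exists s.
  split.
  - by rewrite /F /= setDT image_set0.
  - by move=> A B FA FB; rewrite /F /= setDIr image_setU finite_setU.
  - move=> A B AB; apply: sub_finite_set; apply: image_subset => s [Cs nB].
    by split=> // /AB.
have FC : F C by rewrite /F /= setDv image_set0.
have [s [Cs Fs]] := Cco F FP FC.
have FA : F [set t | C t /\ t n <> s n].
  apply: (@sub_finite_set _ _ [set s n]) => // _ [t [Ct nt] <-].
  by apply: contrapT => tn; apply: nt.
by have [t [[_]]] := Fs _ _ FA (omega_power_nbhs s n).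
Qed.

End omega_power.

(** Convergence of sequences is spelt out coordinatewise, so that the notion
    serves both for [omega_power K] and for the metric space of sequences. *)
Definition seq_usco K (Z : topologicalType) (phi : (nat -> K) -> set Z) :
    Prop :=
  forall (U : set_system ((nat -> K) * Z)) s0, UltraFilter U ->
    U [set p | phi p.1 p.2] -> (forall n, U [set p | p.1 n = s0 n]) ->
    exists2 z, phi s0 z & snd @ U --> z.

Section seq_usco.
Variables (K : Type) (Z : topologicalType).
Implicit Type phi : (nat -> K) -> set Z.

Lemma seq_usco_image_compact phi (C : set (omega_power K)) : seq_usco phi ->
  compact C -> compact [set z | exists2 s, C s & phi s z].
Proof.
move=> uphi; rewrite !compact_ultra => Cco F FU /= FA.
have /choice[s sP] : forall z, exists s : omega_power K,
    (exists2 s, C s & phi s z) -> C s /\ phi s z.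
  move=> z; case: (pselect (exists2 s, C s & phi s z)) => [[s Cs sz]|nz].
    by exists s.
  by have [_ [s Cs _]] := filter_ex FA; exists s => H; case: (nz H).
have sFC : (s @ F) C by apply: (@filterS _ F _ _ _ _ FA) => z /sP[].
have [s0 [Cs0 sFs0]] := Cco (s @ F) (ultra_fmap s FU) sFC.
pose U := (fun z => (s z, z)) @ F.
have [||z s0z Fz] := uphi U s0 (ultra_fmap _ FU).
- by apply: (@filterS _ F _ _ _ _ FA) => z /sP[].
- by move=> n; exact: sFs0 (omega_power_nbhs s0 n).
by exists z; split=> //; exists s0.
Qed.

Lemma seq_usco_compact phi : seq_usco phi -> forall s, compact (phi s).
Proof.
move=> uphi s; rewrite compact_ultra => F FU /= Fs.
have [||z sz Fz] := uphi ((fun z => (s, z)) @ F) s (ultra_fmap _ FU).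
- exact: Fs.
- by move=> n; exact: nearW.
by exists z.
Qed.

End seq_usco.

(** A closed set of the ultrafilter on [Z] meets [phi m0], by upper
    semicontinuity at [m0]; a cluster point in the compact set [phi m0] of these
    traces lies in every such closed set, hence is the limit. *)
Lemma usco_ultra (M Z : topologicalType) (phi : M -> set Z)
    (U : set_system (M * Z)) (m0 : M) : usco phi -> UltraFilter U ->
  U [set p | phi p.1 p.2] -> fst @ U --> m0 ->
  exists2 z, phi m0 z & snd @ U --> z.
Proof.
move=> [phico phiop _] UU Uphi Um0.
have meets A : closed A -> (snd @ U) A -> phi m0 `&` A !=set0.
  move=> Acl UA; apply: contrapT => nA.
  have sub : phi m0 `<=` ~` A by move=> z mz Az; apply: nA; exists z.
  have UnA : U [set p | phi p.1 `<=` ~` A].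
    apply: (Um0 [set m | phi m `<=` ~` A]); apply: open_nbhs_nbhs.
    by split=> //; exact/phiop/closed_openC.
  have {}UA : U [set p | A p.2] by [].
  have [p [/= [pA pphi] Ap]] := filter_ex (filterI (filterI UnA Uphi) UA).
  exact: pA pphi Ap.
pose F := filter_from [set A | closed A /\ (snd @ U) A] (fun A => phi m0 `&` A).
have FP : ProperFilter F.
  apply: filter_from_proper; last by move=> A [Acl UA]; exact: meets.
  apply: filter_from_filter.
    by exists setT; split; [exact: closedT|exact: filterT].
  move=> A B [Acl UA] [Bcl UB]; exists (A `&` B).
    by split; [exact: closedI|exact: filterI].
  by move=> z [? []].
have Fm0 : F (phi m0).
  exists setT; last exact: subIsetl.
  by split; [exact: closedT|exact: filterT].
have [z [mz Fz]] := phico m0 F FP Fm0.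
exists z => // N; rewrite nbhsE => -[V [Vop Vz] VN].
apply: filterS VN _; have [//|UnV] := in_ultra_setVsetC (snd @^-1` V) UU.
have FnV : F (~` V).
  exists (~` V); last exact: subIsetr.
  by split; first exact: open_closedC.
by have [x []] := Fz _ _ FnV (open_nbhs_nbhs (conj Vop Vz)).
Qed.

(** The sequence [s] is sent to the values of [phi] at the points lying, for all
    [n], within [1 / (n + 1)] of the point number [s n] of a dense set.  An
    ultrafilter on such points is Cauchy. *)
Lemma metric_usco_seq (R : realType) (M : completeMetricType R) (K : Type)
    (Z : topologicalType) (phi : M -> set Z) (B : set (set M)) :
  infinite_set [set: K] -> basis B -> B #= [set: K] -> usco phi ->
  exists2 psi : (nat -> K) -> set Z, seq_usco psi & \bigcup_s psi s = setT.
Proof.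
move=> Kinf [Bop Bb] BK uphi.
have [k0 _] := infinite_setN0 Kinf.
have /(card_le_setP k0)[code [_ codeI]] : B #<= [set: K] by case/card_eqPle : BK.
have /choice[d dP] : forall k, exists m : M,
    forall b, B b -> code b = k -> b !=set0 -> b m.
  move=> k; case: (pselect (exists2 b, B b & code b = k /\ b !=set0)).
    move=> [b Bb' [bk [m bm]]]; exists m => c Bc ck _.
    by rewrite -(codeI b c) ?bk ?ck.
  by move=> nb; exists point => b Bb' bk b0; case: nb; exists b.
have ddense (m : M) (e : R) : 0 < e -> exists k, mdist (d k) m < e.
  move=> e0; have [b [Bb' bm] be] := Bb m _ (nbhsx_ballx m e e0).
  exists (code b); rewrite metric_sym.
  have /be : b (d (code b)) by apply: dP => //; exists m.
  by rewrite ballEmdist.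
pose eps n : R := n.+1%:R^-1.
have eps0 n : 0 < eps n by rewrite invr_gt0 ltr0n.
exists (fun s => [set z | exists2 m, forall n, mdist (d (s n)) m <= eps n & phi m z]).
  move=> U s0 UU Uphi Us0.
  have /choice[m mP] : forall p : (nat -> K) * Z, exists m,
      (exists2 m, forall n, mdist (d (p.1 n)) m <= eps n & phi m p.2) ->
      (forall n, mdist (d (p.1 n)) m <= eps n) /\ phi m p.2.
    move=> p; case: (pselect (exists2 m, forall n, mdist (d (p.1 n)) m <= eps n & phi m p.2)).
      by move=> [m ? ?]; exists m.
    by move=> np; exists point => /np.
  have mU n : (m @ U) [set x | mdist (d (s0 n)) x <= eps n].
    apply: (@filterS _ U _ _ _ _ (filterI Uphi (Us0 n))).
    by move=> p /= [/mP[+ _] <-].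
  have UmU := ultra_fmap m UU.
  have /cauchy_cvg /cvg_ex[/= m0 mm0] : cauchy (m @ U).
    apply/cauchyP => e e0.
    have [n ne] : exists n, eps n < e.
      have [n _ /(_ n (leqnn _))] := near_infty_natSinv_lt (PosNum e0).
      by exists n.
    exists (d (s0 n)); apply: filterS (mU n) => x /= xn.
    by rewrite ballEmdist /=; exact: le_lt_trans ne.
  have m0P n : mdist (d (s0 n)) m0 <= eps n.
    apply/ler_addgt0Pr => e e0.
    have me := mm0 _ (nbhsx_ballx m0 e e0).
    have [x [/= xn]] := filter_ex (filterI (mU n) me).
    rewrite ballEmdist /= => xe.
    by apply: le_trans (metric_triangle _ x _) _; rewrite lerD// metric_sym ltW.
  have [||z m0z zP] := @usco_ultra M Z phi ((fun p => (m p, p.2)) @ U) m0 uphi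
    (ultra_fmap _ UU).
  - by apply: (@filterS _ U _ _ _ _ Uphi) => p /mP[].
  - exact: mm0.
  by exists z => //; exists m0.
apply/seteqP; split=> // z _; have [_ _ phicov] := uphi.
have [m _ mz] : (\bigcup_s phi s) z by rewrite phicov.
have /choice[s sP] n := ddense m (eps n) (eps0 n).
by exists s => //; exists m => // n; exact: ltW.
Qed.

(** * The complete metric space of sequences *)

(** The field [R] is a parameter of the type because it is the codomain of the
    metric. *)
Definition baire (R : realType) (K : pointedType) : Type := nat -> K.

Section baire.
Variables (R : realType) (K : pointedType).
Local Notation M := (baire R K).
Implicit Types x y z : M.

HB.instance Definition _ := Choice.copy M (nat -> K).
HB.instance Definition _ := isPointed.Build M (fun=> point).

Definition baire_dist x y : R :=
  if pselect (exists n, x n != y n) is left xy then (ex_minn xy).+1%:R^-1 else 0.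

Lemma baire_dist_ge x y n : x n <> y n -> n.+1%:R^-1 <= baire_dist x y.
Proof.
move=> /eqP xyn; rewrite /baire_dist; case: pselect => [xy|[]]; last by exists n.
by case: ex_minnP => m _ /(_ n xyn) mn; rewrite lef_pV2 ?posrE ?ltr0n// ler_nat.
Qed.

Lemma baire_distP x y : x <> y ->
  exists2 n, x n <> y n & baire_dist x y = n.+1%:R^-1.
Proof.
move=> xy; rewrite /baire_dist; case: pselect => [xyn|nxy].
  by case: ex_minnP => n /eqP xyn' _; exists n.
case: xy; apply/funext => n; apply: contrapT => /eqP xyn.
by apply: nxy; exists n.
Qed.

Lemma baire_distxx x : baire_dist x x = 0.
Proof. by rewrite /baire_dist; case: pselect => // e; have [n] := (e); rewrite eqxx. Qed.

Lemma baire_dist_ge0 x y : 0 <= baire_dist x y.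
Proof. by rewrite /baire_dist; case: pselect. Qed.

Lemma baire_dist_eq0 x y : baire_dist x y = 0 -> x = y.
Proof.
move=> xy; apply: contrapT => /baire_distP[n _]; rewrite xy => /eqP.
by rewrite eq_sym invr_eq0 pnatr_eq0.
Qed.

Lemma baire_dist_sym x y : baire_dist x y = baire_dist y x.
Proof.
suff le x' y' : baire_dist x' y' <= baire_dist y' x'.
  by apply/eqP; rewrite eq_le !le.
case: (pselect (x' = y')) => [->//|/baire_distP[n xyn ->]].
by apply: baire_dist_ge => /esym.
Qed.

Lemma baire_dist_triangle y x z :
  baire_dist x z <= baire_dist x y + baire_dist y z.
Proof.
case: (pselect (x = z)) => [->|/baire_distP[n xzn ->]].
  by rewrite baire_distxx addr_ge0// baire_dist_ge0.
case: (pselect (x n = y n)) => [xyn|xyn].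
  by rewrite -[leLHS]add0r lerD// ?baire_dist_ge0// baire_dist_ge// -xyn.
by rewrite -[leLHS]addr0 lerD// ?baire_dist_ge0// baire_dist_ge.
Qed.

HB.instance Definition _ := isMetric.Build R M
  baire_distxx baire_dist_eq0 baire_dist_sym baire_dist_triangle.

Lemma baire_ballP x y n :
  ball x n.+1%:R^-1 y <-> forall i, (i <= n)%N -> x i = y i.
Proof.
rewrite ballEmdist /= -[mdist x y]/(baire_dist x y); split=> [xy i ni|xy].
  apply: contrapT => /baire_dist_ge; apply/negP; rewrite -ltNge.
  by apply: lt_le_trans xy _; rewrite lef_pV2 ?posrE ?ltr0n// ler_nat.
case: (pselect (x = y)) => [->|/baire_distP[m xym]].
  by rewrite baire_distxx invr_gt0 ltr0n.
move=> ->; rewrite ltf_pV2 ?posrE ?ltr0n// ltr_nat ltnNge.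
by apply/negP => /xy.
Qed.

Lemma baire_nbhsP x (A : set M) : nbhs x A <->
  exists n, forall y, (forall i, (i <= n)%N -> x i = y i) -> A y.
Proof.
split=> [/nbhs_ballP[e e0 eA]|[n nA]].
  have [n _ /(_ n (leqnn _)) ne] := near_infty_natSinv_lt (PosNum e0).
  exists n => y /baire_ballP xy; apply: eA.
  exact: le_ball (ltW ne) _ xy.
apply/nbhs_ballP; exists n.+1%:R^-1; first by rewrite /= invr_gt0 ltr0n.
by move=> y /baire_ballP; exact: nA.
Qed.

Lemma baire_coord_nbhs x n : nbhs x [set y : M | y n = x n].
Proof. by apply/baire_nbhsP; exists n => y ->. Qed.

Lemma baire_complete (F : set_system M) : ProperFilter F -> cauchy F -> cvg F.
Proof.
move=> FF Fc.
have /choice[v vF] n : exists v : K, F [set y : M | y n = v].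
  have [|x xF] := (@cauchyP R M F FF).1 Fc n.+1%:R^-1; first by rewrite invr_gt0 ltr0n.
  exists (x n); apply: filterS xF => y /baire_ballP/(_ n (leqnn _)).
  by move=> ->.
apply/cvg_ex; exists (v : M) => A /baire_nbhsP[n nA].
have : F [set y : M | forall i, (i <= n)%N -> v i = y i].
  elim: n {nA} => [|n IH].
    by apply: filterS (vF 0%N) => y /= y0 i; rewrite leqn0 => /eqP->.
  apply: filterS (filterI IH (vF n.+1)) => y [/= yn yS] i.
  by rewrite leq_eqVlt => /predU1P[->//|]; rewrite ltnS => /yn.
by apply: filterS => y; exact: nA.
Qed.

HB.instance Definition _ := Uniform_isComplete.Build M baire_complete.

End baire.

(** Cylinders form a basis of size [seq K]; conversely, the basic open sets
    containing the constant sequence [k] inside the cylinder of first coordinate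
    [k] are distinct for distinct [k]. *)
Lemma baire_weight (R : realType) (K : pointedType) : infinite_set [set: K] ->
  is_weight (baire R K) K.
Proof.
move=> Kinf.
pose cyl (s : seq K) : set (baire R K) :=
  [set x | forall i, (i < size s)%N -> x i = nth point s i].
have cylP (x : baire R K) n y : cyl (mkseq x n) y <->
    forall i, (i < n)%N -> x i = y i.
  rewrite /cyl /= size_mkseq; split=> xy i ni.
    by rewrite xy// nth_mkseq.
  by rewrite nth_mkseq// xy.
have cyl_open s : open (cyl s).
  rewrite openE => x sx; apply/baire_nbhsP; exists (size s) => y xy i si.
  by rewrite -xy ?sx// ltnW.
have cyl_basis : basis (range cyl).
  split; first by move=> _ [s _ <-].
  move=> x A /= /baire_nbhsP[n nA]; exists (cyl (mkseq x n.+1)).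
    by split; [exists (mkseq x n.+1)|apply/cylP].
  by move=> y /cylP xy; apply: nA.
have lower (L : Type) (B : set (set (baire R K))) : basis B -> B #= [set: L] ->
    [set: K] #<= [set: L].
  move=> [Bop Bb] /card_eqPle[/(card_le_trans _) le _]; apply: le.
  rewrite -(card_le_eqr (card_setT B)).
  apply: (@card_le_rel _ _ (fun k (b : B) => set_val b (fun=> k) /\
      set_val b `<=` [set x : baire R K | x 0%N = k])) => [k|k k' b].
    have [b [Bb' bk] bs] := Bb (fun=> k) _ (baire_coord_nbhs (fun=> k) 0%N).
    by exists (SigSub (mem_set Bb')).
  by move=> [bk _] [_ /(_ _ bk)].
split; last by move=> L' [B Bb]; exact: lower.
exists (range cyl) => //; apply/card_eqPle; split.
  apply: card_le_trans (card_image_le _ _) _.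
  exact: card_seq_le Kinf (card_lexx _).
rewrite -(card_le_eqr (card_setT (range cyl))).
apply: lower cyl_basis _; exact: card_setT_sym.
Qed.

Lemma seq_usco_baire (R : realType) (K : pointedType) (Z : topologicalType)
    (phi : (nat -> K) -> set Z) : seq_usco phi -> \bigcup_s phi s = setT ->
  usco (phi : baire R K -> set Z).
Proof.
move=> uphi phicov; split=> // [s|A Aop].
  exact: seq_usco_compact.
rewrite openE => s0 /= s0A; apply: contrapT => nA.
pose F := filter_from (nbhs (s0 : baire R K)) (fun N =>
  [set p : (nat -> K) * Z | [/\ N p.1, phi p.1 p.2 & ~ A p.2]]).
have FP : ProperFilter F.
  apply: filter_from_proper; last first.
    move=> N s0N; apply: contrapT => N0; apply: nA.
    apply: filterS s0N => s Ns z sz; apply: contrapT => nAz.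
    by apply: N0; exists (s, z).
  apply: filter_from_filter; first by exists setT; exact: filterT.
  move=> N1 N2 n1 n2; exists (N1 `&` N2); first exact: filterI.
  by move=> p [[? ?] ? ?].
have [U [UU FU]] := ultraFilterLemma FP.
have [||z s0z Uz] := uphi U s0 UU.
- by apply: FU; exists setT; [exact: filterT|move=> p []].
- move=> n; apply: FU; exists [set s | s n = s0 n].
    exact: (@baire_coord_nbhs R K).
  by move=> p [].
have UA : U [set p | A p.2] by apply: Uz; apply: open_nbhs_nbhs; split=> //; exact: s0A.
have UnA : U [set p | ~ A p.2].
  by apply: FU; exists setT; [exact: filterT|move=> p []].
by have [p []] := filter_ex (filterI UA UnA).
Qed.

Lemma seq_usco_metric (R : realType) (K : Type) (Z : topologicalType)
    (phi : (nat -> K) -> set Z) : infinite_set [set: K] ->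
    seq_usco phi -> \bigcup_s phi s = setT ->
  exists M : completeMetricType R, is_weight M K /\
    exists psi : M -> set Z, usco psi.
Proof.
move=> Kinf; have [k0 _] := infinite_setN0 Kinf.
move: K Kinf k0 phi; elim/Ppointed => K Kinf k0 phi uphi phicov.
  by case: (no k0).
exists (baire R K); split; first exact: baire_weight.
by exists phi; exact: seq_usco_baire.
Qed.

(** * Operations on weakly compact valued uscos *)

Lemma filter_choice (T Q : Type) (F : set_system T) (r : T -> Q -> Prop) :
  ProperFilter F -> F [set t | exists q, r t q] ->
  exists m : T -> Q, F [set t | r t (m t)].
Proof.
move=> FF Fr; have [_ [q0 _]] := filter_ex Fr.
have /choice[m mP] t : exists q, (exists q', r t q') -> r t q.
  case: (pselect (exists q', r t q')) => [[q rq]|nr]; first by exists q.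
  by exists q0.
by exists m; apply: filterS Fr => t /mP.
Qed.

Section weak_usco.
Variables (R : realType) (X : completeNormedModType R) (K : Type).
Local Notation W := (weak_space X).
Implicit Types phi psi : (nat -> K) -> set W.

Lemma seq_usco_along (Z : topologicalType) (phi : (nat -> K) -> set Z)
    (T : Type) (U : set_system T) (s : T -> nat -> K) (z : T -> Z) s0 :
    seq_usco phi -> UltraFilter U -> U [set t | phi (s t) (z t)] ->
    (forall n, U [set t | s t n = s0 n]) ->
  exists2 z0, phi s0 z0 & z @ U --> z0.
Proof.
move=> uphi UU Uphi Us.
exact: (uphi _ s0 (ultra_fmap (fun t => (s t, z t)) UU) Uphi Us).
Qed.

Lemma weak_cvg_fmapP (T : Type) (U : set_system T) (g : T -> W) (x : W) :
  Filter U -> g @ U --> x <->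
  forall f : {linear X -> R^o}, continuous f -> (fun t => f (g t)) @ U --> f x.
Proof.
move=> UF; split=> [gx f fc|gx].
  apply/cvgrPdist_lt => e e0.
  exact: ((weak_cvgP x _).1 gx f fc e e0).
apply/weak_cvgP => f fc e e0.
exact: ((@cvgrPdist_lt _ _ _ _ _ _ _).1 (gx f fc) e e0).
Qed.

Lemma seq_usco0 : seq_usco (fun _ : nat -> K => [set (0 : W)]).
Proof.
move=> U s0 UU U0 _; exists (0 : W) => //.
apply/weak_cvg_fmapP => f fc; apply/cvgrPdist_lt => e e0.
by apply: filterS U0 => p /= ->; rewrite subrr normr0.
Qed.

Lemma seq_usco_scale_add phi psi (b : R) : seq_usco phi -> seq_usco psi ->
  seq_usco (fun s => [set x : W | exists a (y z : X),
    [/\ `|a| <= b, phi s y, psi s z & x = a *: y + z]]).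
Proof.
move=> uphi upsi U s0 UU Ux Us.
have [m Um] : exists m : (nat -> K) * W -> R * X * X, U [set p |
    [/\ `|(m p).1.1| <= b, phi p.1 (m p).1.2, psi p.1 (m p).2 &
        p.2 = (m p).1.1 *: (m p).1.2 + (m p).2 :> X]].
  apply: (@filter_choice _ _ U (fun p q => [/\ `|q.1.1| <= b,
    phi p.1 q.1.2, psi p.1 q.2 & p.2 = q.1.1 *: q.1.2 + q.2 :> X])).
  by apply: filterS Ux => p [a [y [z ayz]]]; exists (a, y, z).
have [||y0 s0y0 yU] := @seq_usco_along W phi _ U (fun p => p.1)
  (fun p => (m p).1.2 : W) s0 uphi UU => //.
  by apply: filterS Um => p [].
have [||z0 s0z0 zU] := @seq_usco_along W psi _ U (fun p => p.1)
  (fun p => (m p).2 : W) s0 upsi UU => //.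
  by apply: filterS Um => p [].
have : compact `[- b, b] by exact: segment_compact.
rewrite compact_ultra => /(_ ((fun p => (m p).1.1) @ U) (ultra_fmap _ UU)).
case; first by apply: (@filterS _ U _ _ _ _ Um) => p [+ _ _ _] /=; rewrite in_itv /= ler_norml.
move=> a0 [a0b aU].
exists (a0 *: (y0 : X) + z0 : X).
  by exists a0, y0, z0; split=> //; move: a0b; rewrite /= in_itv /= ler_norml.
apply/weak_cvg_fmapP => f fc.
have lim : (fun p => (m p).1.1 * f (m p).1.2 + f (m p).2) @ U -->
    a0 * f y0 + f z0.
  apply: cvgD; last exact: (weak_cvg_fmapP _ _ _).1.
  by apply: cvgM => //; exact: (weak_cvg_fmapP _ _ _).1.
rewrite linearD linearZ; apply: cvg_trans lim; apply: near_eq_cvg.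
by apply: filterS Um => p [_ _ _ ->]; rewrite linearD linearZ.
Qed.

(** A parameter that depends on a single coordinate is eventually constant. *)
Lemma seq_usco_switch (Q : Type) (phi : Q -> (nat -> K) -> set W)
    (c : (nat -> K) -> Q) i : (forall q, seq_usco (phi q)) ->
    (forall s t, s i = t i -> c s = c t) ->
  seq_usco (fun s => phi (c s) s).
Proof.
move=> uphi cP U s0 UU Uphi Us; apply: (uphi (c s0)) => //.
by apply: filterS (filterI Uphi (Us i)) => p [/= + /cP <-].
Qed.

(** Grothendieck's criterion.  Along the ultrafilter the approximants [k p n]
    converge weakly to points [y n] of [phi n s0].  Closed balls being weakly
    closed, [y n] and [y m] are within [1 / (n + 1) + 1 / (m + 1)], so [y] is a
    Cauchy sequence for the norm, and its limit is the weak limit sought. *)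
Lemma seq_usco_approx (phi : nat -> (nat -> K) -> set W) :
  (forall n, seq_usco (phi n)) ->
  seq_usco (fun s => [set x : W | forall n, exists2 y, phi n s y &
    `|(x : X) - (y : X)| <= n.+1%:R^-1]).
Proof.
move=> uphi U s0 UU Ux Us.
have [k Uk] : exists k : (nat -> K) * W -> nat -> X, U [set p | forall n,
    phi n p.1 (k p n) /\ `|(p.2 : X) - k p n| <= n.+1%:R^-1].
  apply: (@filter_choice _ _ U (fun p k => forall n,
    phi n p.1 (k n) /\ `|(p.2 : X) - k n| <= n.+1%:R^-1)).
  apply: filterS Ux => p px.
  have /choice[y yP] n : exists y : X,
      phi n p.1 y /\ `|(p.2 : X) - y| <= n.+1%:R^-1.
    by have [y ? ?] := px n; exists y.
  by exists y.
have /choice[y yP] n : exists y : W, phi n s0 y /\ (fun p => k p n : W) @ U --> y.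
  have [||y s0y yU] := @seq_usco_along W (phi n) _ U (fun p => p.1)
    (fun p => k p n : W) s0 (uphi n) UU => //; last by exists y.
  by apply: filterS Uk => p /(_ n)[].
have ydist n m : `|(y n : X) - y m| <= n.+1%:R^-1 + m.+1%:R^-1.
  apply: (@weak_limit_norm_le R X ((fun p => k p n - k p m : W) @ U)).
    apply/weak_cvg_fmapP => f fc; rewrite linearB.
    under eq_fun do rewrite linearB.
    by apply: cvgB; apply: (weak_cvg_fmapP _ _ _).1 => //; exact: (yP _).2.
  apply: (@filterS _ U _ _ _ _ Uk) => p kp /=.
  rewrite -(subrKA (p.2 : X)); apply: le_trans (ler_normD _ _) _.
  by rewrite distrC lerD //; exact: (kp _).2.
have : cvg ((y : nat -> X) @ \oo).
  apply: cauchy_cvg; apply: (@cauchy_exP R X) => e e0.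
  have e20 : 0 < e / 2 by rewrite divr_gt0.
  have [n _ nP] := near_infty_natSinv_lt (PosNum e20).
  exists (y n); exists n => // m /= nm; rewrite -ball_normE /=.
  apply: le_lt_trans (ydist n m) _.
  by rewrite [e]splitr; apply: ltrD; [exact: (nP n (leqnn n))|exact: (nP m nm)].
move=> /cvg_ex[x yx].
have xdist n : `|x - y n| <= n.+1%:R^-1.
  apply/ler_addgt0Pr => e e0.
  have e20 : 0 < e / 2 by rewrite divr_gt0.
  have [m _ mP] := near_infty_natSinv_lt (PosNum e20).
  have [m' _ m'P] := (@cvgrPdist_lt _ _ _ _ _ _ _).1 yx _ e20.
  pose M := maxn m m'.
  rewrite -(subrKA (y M : X)); apply: le_trans (ler_normD _ _) _.
  rewrite [leLHS]addrC [e]splitr addrA lerD//; last first.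
    by apply/ltW/(m'P M); rewrite /= leq_maxr.
  apply: le_trans (ydist M n) _; rewrite [leRHS]addrC lerD2r; apply/ltW/(mP M).
  by rewrite /= leq_maxl.
exists x; first by move=> n; exists (y n); [exact: (yP n).1|exact: xdist].
apply/weak_cvg_fmapP => f fc; apply/cvgrPdist_lt => e e0.
have [C C0 fC] := continuous_dominated fc.
have e30 : 0 < e / 3 / C by rewrite !divr_gt0.
have [n _ /(_ n (leqnn _)) /= nP] := near_infty_natSinv_lt (PosNum e30).
have small (u v : X) : `|u - v| <= n.+1%:R^-1 -> `|f u - f v| < e / 3.
  move=> uv; rewrite -linearB; apply: le_lt_trans (fC _) _.
  rewrite mulrC -ltr_pdivlMr//; exact: le_lt_trans nP.
have e30' : 0 < e / 3 by rewrite divr_gt0.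
have UF : Filter U by exact: _.
have yn : (fun p => f (k p n)) @ U --> f (y n).
  exact: (weak_cvg_fmapP _ _ _).1 (yP n).2 f fc.
have Uyn : U [set p | `|f (y n) - f (k p n)| < e / 3].
  exact: (@cvgrPdist_lt _ _ _ _ _ _ _).1 yn _ e30'.
apply: filterS (filterI Uk Uyn) => p [/(_ n)[_ kp] /= ykp].
have -> : e = e / 3 + e / 3 + e / 3 by field.
rewrite -(subrKA (f (k p n))); apply: le_lt_trans (ler_normD _ _) _.
rewrite ltrD//; last by rewrite distrC; exact: small.
rewrite -(subrKA (f (y n))); apply: le_lt_trans (ler_normD _ _) _.
by rewrite ltrD//; exact: small.
Qed.

End weak_usco.

Lemma seq_usco_reindex (K K' : Type) (Z : topologicalType)
    (phi : (nat -> K') -> set Z) (h : (nat -> K) -> nat -> K') (p : nat -> nat) :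
    seq_usco phi -> (forall s t j, s (p j) = t (p j) -> h s j = h t j) ->
  seq_usco (phi \o h).
Proof.
move=> uphi hP U s0 UU Uphi Us.
apply: (@seq_usco_along K' Z phi _ U (fun q => h q.1) snd) => // n.
by apply: filterS (Us (p n)) => q /= /hP.
Qed.

(** * Generation by linear combinations *)

Section combinations.
Variables (R : realType) (X : lmodType R).

(** The bound [b] on the coefficients preserves compactness of the [A i]; taking
    it among the integers leaves only countably many shapes [(b, l)] of linear
    combinations. *)
Fixpoint comb (b : R) (l : nat) (A : nat -> set X) : set X :=
  if l is l'.+1 then
    [set x | exists a y z, [/\ `|a| <= b, A l' y, comb b l' A z & x = a *: y + z]]
  else [set 0].

Definition lin_span (D : set X) : set X :=
  [set x | exists b l, comb b l (fun=> D) x].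

Lemma comb_mono b b' l (A A' : nat -> set X) : b <= b' ->
  (forall i, (i < l)%N -> A i `<=` A' i) -> comb b l A `<=` comb b' l A'.
Proof.
move=> bb'; elim: l => [|l IH] AA' x; first by [].
move=> [a [y [z [ab Ay Az ->]]]].
exists a, y, z; split=> //; first exact: le_trans bb'.
  exact: AA' Ay.
by apply: IH Az => i il; apply: AA'; exact: ltnW.
Qed.

Lemma comb_cat b l l' (D : set X) x y : comb b l (fun=> D) x ->
  comb b l' (fun=> D) y -> comb b (l + l') (fun=> D) (x + y).
Proof.
move=> + Dy; elim: l x => [x ->|l IH x]; first by rewrite add0r.
move=> [a [u [v [ab Du Dv ->]]]]; exists a, u, (v + y); split=> //.
  exact: IH.
by rewrite addrA.
Qed.

Lemma comb_scale b l (D : set X) a x : comb b l (fun=> D) x ->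
  comb (`|a| * b) l (fun=> D) (a *: x).
Proof.
elim: l x => [x ->|l IH x [c [y [z [cb Dy Dz ->]]]]]; first by rewrite /= scaler0.
exists (a * c), y, (a *: z); split=> //; last by rewrite scalerDr scalerA.
  by rewrite normrM ler_wpM2l.
exact: IH.
Qed.

Lemma lin_span0 (D : set X) : lin_span D 0.
Proof. by exists 0, 0%N. Qed.

Lemma lin_spanD (D : set X) x y : lin_span D x -> lin_span D y ->
  lin_span D (x + y).
Proof.
move=> [b [l Dx]] [c [m Dy]]; exists (Num.max b c), (l + m)%N.
apply: comb_cat; [apply: comb_mono Dx|apply: comb_mono Dy].
- by rewrite le_max lexx.
- by move=> i _; exact: subset_refl.
- by rewrite le_max lexx orbT.
- by move=> i _; exact: subset_refl.
Qed.

Lemma lin_spanZ (D : set X) (a : R) x : lin_span D x -> lin_span D (a *: x).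
Proof. by move=> [b [l Dx]]; exists (`|a| * b), l; exact: comb_scale. Qed.

Lemma lin_span_sub (D : set X) : D `<=` lin_span D.
Proof.
move=> x Dx; exists 1, 1%N; exists 1, x, 0.
by rewrite normr1 scale1r addr0.
Qed.

Lemma lin_span_bigcup (I : Type) (A : I -> set X) (i0 : I) x :
  lin_span (\bigcup_i A i) x -> exists (m l : nat) (i : nat -> I),
    comb m%:R l (fun j => A (i j)) x.
Proof.
move=> [b [l]].
have [m bm] : exists m : nat, b <= m%:R.
  by exists (Num.truncn b).+1; apply/ltW; exact: truncnS_gt.
elim: l x => [x ->|l IH x [a [y [z [ab [i _ Aiy] /IH[m' [l' [j zj]]] ->]]]]].
  by exists 0%N, 0%N, (fun=> i0).
exists (maxn m m'), l'.+1, (fun k => if k == l' then i else j k).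
exists a, y, z; rewrite eqxx; split=> //.
  by apply: le_trans ab _; apply: le_trans bm _; rewrite ler_nat leq_maxl.
apply: comb_mono zj; first by rewrite ler_nat leq_maxr.
by move=> k kl; rewrite ltn_eqF.
Qed.

End combinations.

Section generation.
Variables (R : realType) (X : completeNormedModType R).
Local Notation W := (weak_space X).

Lemma seq_usco_comb (K : Type) (phi : nat -> (nat -> K) -> set W) b l :
  (forall i, seq_usco (phi i)) ->
  seq_usco (fun s => comb b l (fun i => phi i s : set X) : set W).
Proof.
move=> uphi; elim: l => [|l IH]; first exact: seq_usco0.
exact: seq_usco_scale_add.
Qed.

Lemma seq_usco_cst (K : Type) (Z : topologicalType) (C : set Z) : compact C ->
  seq_usco (fun _ : nat -> K => C).
Proof.
rewrite compact_ultra => Cco U s0 UU UC _.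
by have [z [Cz zU]] := Cco (snd @ U) (ultra_fmap _ UU) UC; exists z.
Qed.

Lemma seq_usco_coord (K : Type) (C : K -> set W) i :
  (forall k, compact (C k)) ->
  seq_usco (fun s => C (s i)).
Proof.
move=> Cco; apply: (@seq_usco_switch R X K K (fun k _ => C k) (fun s => s i) i) => // k.
exact: seq_usco_cst.
Qed.

(** A sequence over [K] encodes, for each [n], a shape of linear combination and
    the arguments of [phi] that enter it; its value is the set of points within
    [1 / (n + 1)] of the [n]-th set of combinations for all [n].  This is Talagrand's
    proof that weakly compactly generated spaces are weakly K-analytic. *)
Theorem seq_usco_generate (K : Type) (phi : (nat -> K) -> set W) :
    infinite_set [set: K] -> seq_usco phi ->
    (forall (x : X) (e : R), 0 < e ->
       exists2 y, lin_span (\bigcup_s phi s : set X) y & `|x - y| < e) ->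
  exists2 psi : (nat -> K) -> set W, seq_usco psi & \bigcup_s psi s = setT.
Proof.
move=> Kinf uphi phidense.
have [k0 _] := infinite_setN0 Kinf.
have /card_leTTP[enc encI] : [set: nat * nat * K] #<= [set: K].
  have NK := card_nat_le Kinf.
  by apply: card_prod_le2 => //; exact: card_prod_le2.
have [dec decK] : exists dec : K -> nat * nat * K, cancel enc dec.
  have /choice[dec decP] k : exists q, forall q', enc q' = k -> q' = q.
    case: (pselect (exists q, enc q = k)) => [[q <-]|nk].
      by exists q => q' /encI.
    by exists (0%N, 0%N, k0) => q' qk; case: nk; exists q'.
  by exists dec => q; rewrite -(decP (enc q) q).
(* the coordinate [pickle (n, i, j)] carries the [j]-th term of the [i]-th
   argument of the [n]-th combination, whose shape is read at [i = j = 0] *)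
pose bnd (s : nat -> K) (n : nat) := (dec (s (pickle (n, 0%N, 0%N)))).1.1.
pose len (s : nat -> K) (n : nat) := (dec (s (pickle (n, 0%N, 0%N)))).1.2.
pose pt (n i : nat) (s : nat -> K) (j : nat) := (dec (s (pickle (n, i, j)))).2.
pose chi n (s : nat -> K) : set W :=
  comb (bnd s n)%:R (len s n) (fun i => phi (pt n i s) : set X).
have uchi n : seq_usco (chi n).
  pose c (s : nat -> K) := (bnd s n, len s n).
  apply: (@seq_usco_switch R X K (nat * nat) (fun q s => comb q.1%:R q.2
    (fun i => phi (pt n i s) : set X)) c (pickle (n, 0%N, 0%N))).
    move=> q; apply: seq_usco_comb => i.
    by apply: (seq_usco_reindex (p := fun j => pickle (n, i, j)) uphi) => s t j st;
      rewrite /pt st.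
  by move=> s t st; rewrite /c /bnd /len st.
exists (fun s => [set x : W | forall n, exists2 y, chi n s y &
    `|(x : X) - (y : X)| <= n.+1%:R^-1]); first exact: seq_usco_approx.
apply/seteqP; split=> // x _.
have /choice[f fP] n : exists f : nat * nat * (nat -> nat -> K), exists2 y,
    comb f.1.1%:R f.1.2 (fun i => phi (f.2 i) : set X) y &
    `|(x : X) - y| <= n.+1%:R^-1.
  have [|y] := phidense (x : X) n.+1%:R^-1; first by rewrite invr_gt0 ltr0n.
  move=> /(lin_span_bigcup (fun=> k0))[b [l [i yi]]] xy.
  by exists (b, l, i), y => //; exact: ltW.
pose s p := let q := odflt (0%N, 0%N, 0%N) (unpickle p) in
  enc ((f q.1.1).1.1, (f q.1.1).1.2, (f q.1.1).2 q.1.2 q.2).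
have sE n i j : dec (s (pickle (n, i, j))) = ((f n).1.1, (f n).1.2, (f n).2 i j).
  by rewrite /s pickleK /= decK.
exists s => // n; have [y yf xy] := fP n; exists y => //.
rewrite /chi /bnd /len sE /=; apply: comb_mono yf => // i _.
suff -> : pt n i s = (f n).2 i by [].
by apply/funext => j; rewrite /pt sE.
Qed.

Lemma norm_dense_weak_dense (D : set W) :
  (forall (x : X) (e : R), 0 < e -> exists2 y : X, D y & `|x - y| < e) ->
  dense D.
Proof.
move=> Dd A [x Ax] Aop.
have : nbhs (x : X) A.
  have xx : (nbhs (x : X) : set_system W) --> x.
    apply/weak_cvgP => f fc e e0.
    exact: ((@cvgrPdist_lt _ _ _ _ _ _ _).1 (fc x) e e0).
  by apply: xx; exact: open_nbhs_nbhs.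
move=> /nbhs_ballP[e e0 eA]; have [y Dy xy] := Dd x e e0.
by exists y; split=> //; apply: eA; rewrite -ball_normE.
Qed.

(** Passage from a dense span to a dense union, at no cost in the number of
    compact sets. *)
Theorem compact_generate (T : Type) (C : T -> set W) : infinite_set [set: T] ->
    (forall t, compact (C t)) ->
    (forall (x : X) (e : R), 0 < e ->
       exists2 y, lin_span (\bigcup_t C t : set X) y & `|x - y| < e) ->
  exists C' : T -> set W, (forall t, compact (C' t)) /\ dense (\bigcup_t C' t).
Proof.
move=> Tinf Cco Cd; have [t0 _] := infinite_setN0 Tinf.
have /card_leTTP[enc encI] : [set: nat * seq T] #<= [set: T].
  apply: card_prod_le2 => //; first exact: card_nat_le.
  exact: card_seq_le.
pose D (q : nat * seq T) : set W :=
  comb q.1%:R (size q.2) (fun i => C (nth t0 q.2 i) : set X).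
have Dco q : compact (D q).
  have uD : seq_usco (fun s : nat -> T => comb q.1%:R (size q.2)
      (fun i => C (s i) : set X) : set W).
    by apply: (@seq_usco_comb T (fun i s => C (s i))) => i; exact: seq_usco_coord.
  exact (@seq_usco_compact _ _ _ uD (nth t0 q.2)).
exists (fun t => [set x | exists2 q, enc q = t & D q x]); split=> [t|].
  case: (pselect (exists q, enc q = t)) => [[q <-]|nt].
    rewrite (_ : [set x | _] = D q)//; apply/seteqP; split=> [x [q' /encI ->]|x Dx] //.
    by exists q.
  rewrite (_ : [set x | _] = set0); first exact: compact0.
  by apply/seteqP; split=> // x [q qt]; case: nt; exists q.
apply: norm_dense_weak_dense => x e e0.
have [y] := Cd x e e0; move=> /(lin_span_bigcup t0)[b [l [i yi]]] xy.
exists y => //; exists (enc (b, mkseq i l)) => //; exists (b, mkseq i l) => //.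
rewrite /D /= size_mkseq; apply: comb_mono yi => // j jl.
by rewrite nth_mkseq.
Qed.

End generation.

(** * Cardinal inequalities in a Banach space *)

(** Constant sequences form an infinite closed discrete set. *)
Lemma const_seq_infinite (K J : Type) (e : nat -> K)
    (C : J -> set (omega_power K)) :
  injective e -> finite_set [set: J] -> (forall j, compact (C j)) ->
  ~ (range (fun n => (fun=> e n) : omega_power K) `<=` \bigcup_j C j).
Proof.
move=> eI Jfin Cco cover; apply: infinite_nat.
rewrite (_ : [set: nat] = \bigcup_j [set n | C j (fun=> e n)]); last first.
  apply/seteqP; split=> // n _.
  by have [j _ Cj] := cover _ (imageP _ (I : setT n)); exists j.
apply: bigcup_finite => // j _.
have Cfin := compact_coord_finite 0 (Cco j).
apply: (@sub_finite_set _ _ (e @^-1` [set s 0%N | s in C j])).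
  by move=> n Cn; exists (fun=> e n).
by apply: finite_preimage => // x y _ _ /eI.
Qed.

Lemma omega_power_cover_infinite (K J : Type) (C : J -> set (omega_power K)) :
    infinite_set [set: K] -> (forall j, compact (C j)) ->
    \bigcup_j C j = [set: omega_power K] ->
  infinite_set [set: J].
Proof.
move=> /infiniteP/card_leTTP[e eI] Cco Ccov Jfin.
by apply: (const_seq_infinite eI Jfin Cco); rewrite Ccov.
Qed.

Section necessity.
Variables (R : realType) (X : completeNormedModType R) (kappa tau delta : Type).
Hypotheses (kappa_inf : infinite_set [set: kappa])
  (delta_inf : infinite_set [set: delta]).
Local Notation W := (weak_space X).
Hypotheses (XlK : is_lK R W kappa) (XCG : is_CG W tau).
Hypothesis Xd : is_density X delta.

Lemma lK_le_CG : [set: kappa] #<= [set: tau].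
Proof.
have [_ lKmin] := XlK; have [[tau_inf [C [Cco Cd]]] _] := XCG.
apply: lKmin; split=> //.
have CE : \bigcup_s C (s 0%N) = \bigcup_t C t.
  apply/seteqP; split=> x; first by move=> [s _ Cx]; exists (s 0%N).
  by move=> [t _ Cx]; exists (fun=> t).
have [||psi upsi psicov] := @seq_usco_generate R X tau (fun s => C (s 0%N)) tau_inf.
- exact: seq_usco_coord.
- move=> x e e0; rewrite CE; apply: (weak_dense_cball x Cd) => //.
  + exact: lin_span_sub.
  + exact: lin_span0.
  + exact: lin_spanD.
  + exact: lin_spanZ.
exact: seq_usco_metric upsi psicov.
Qed.

Lemma lK_seq_usco :
  exists2 psi : (nat -> kappa) -> set W, seq_usco psi & \bigcup_s psi s = setT.
Proof.
have [[_ [M [[[B Bb BK] _] [phi uphi]]]] _] := XlK.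
exact: metric_usco_seq kappa_inf Bb BK uphi.
Qed.

Lemma CG_le_d : exists2 d : Type, is_d kappa d & [set: tau] #<= [set: d].
Proof.
have [psi upsi psicov] := lK_seq_usco.
have [d dP] : exists d, is_d kappa d.
  apply: (@least_cardinalP _ (omega_power kappa)).
  exists set1; split; first exact: compact_set1.
  by apply/seteqP; split=> // s _; exists s.
exists d => //; have [[C [Cco Ccov]] _] := dP; have [_ CGmin] := XCG.
apply: CGmin; split; first exact: omega_power_cover_infinite Ccov.
exists (fun l => [set z | exists2 s, C l s & psi s z]); split=> [l|].
  exact: seq_usco_image_compact.
move=> A A0 _; rewrite (_ : \bigcup_l _ = setT) ?setIT//.
apply/seteqP; split=> // z _; have [s _ sz] : (\bigcup_s psi s) z by rewrite psicov.
have [l _ Cs] : (\bigcup_l C l) s by rewrite Ccov.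
by exists l => //; exists s.
Qed.

Lemma b_le_density :
  exists2 b : Type, is_b kappa tau b & [set: b] #<= [set: delta].
Proof.
have [psi upsi psicov] := lK_seq_usco.
have [[S Sd Sdelta] _] := Xd; have [_ CGmin] := XCG.
have [d0 _] := infinite_setN0 delta_inf.
have /infiniteP/card_leTTP[e eI] := kappa_inf.
have /choice[sig sigP] (x : W) : exists s, psi s x.
  by have [s _ sx] : (\bigcup_s psi s) x; [rewrite psicov|exists s].
(* the constant sequences take care of finite covers: the minimality of [tau]
   only concerns infinite index sets *)
pose A := (sig @` S) `|` range (fun n => (fun=> e n) : omega_power kappa).
have noncov (J : Type) (C : J -> set (omega_power kappa)) :
    card_lt [set: J] [set: tau] -> (forall i, compact (C i)) ->
    ~ (A `<=` \bigcup_i C i).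
  move=> [_ tauJ] Cco Acov.
  have [Jfin|Jinf] := pselect (finite_set [set: J]).
    by apply: (const_seq_infinite eI Jfin Cco) => s es; apply: Acov; right.
  apply: tauJ; apply: CGmin; split=> //.
  exists (fun j => [set z | exists2 s, C j s & psi s z]); split=> [j|].
    exact: seq_usco_image_compact.
  apply: norm_dense_weak_dense => x r r0.
  have [||y [xy Sy]] := Sd (ball x r).
  - by exists x; exact: ballxx.
  - exact: ball_open.
  exists y; last by move: xy; rewrite -ball_normE.
  have [j _ Cj] : (\bigcup_j C j) (sig y) by apply: Acov; left; exists y.
  by exists j => //; exists (sig y).
have [b bP] : exists b, is_b kappa tau b.
  by apply: (@least_cardinalP _ A); exists A => //; exact: card_setT_sym.
exists b => //; have [_ bmin] := bP.
have /card_le_trans : [set: b] #<= [set: A].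
  by apply: bmin; exists A => //; exact: card_setT_sym.
apply; apply: card_le_trans
  (card_sum_le delta_inf (card_lexx _) (card_nat_le delta_inf)).
have /(card_le_setP d0)[f [_ fI]] : S #<= [set: delta] by case/card_eqPle : Sdelta.
apply: (@card_le_rel _ _ (fun a u => match u with
  | inl d => exists2 x, S x & sig x = set_val a /\ f x = d
  | inr n => set_val a = (fun=> e n) end)) => [a|a a' [d|n]].
- have /set_mem[[x Sx xa]|[n _ na]] := valP a.
    by exists (inl (f x)); exists x.
  by exists (inr n).
- move=> [x Sx [xa xd]] [x' Sx' [xa' xd']].
  have aa' : set_val a = set_val a' by rewrite -xa -xa' (fI x x')// xd.
  exact: val_inj aa'.
- move=> an a'n; have aa' : set_val a = set_val a' by rewrite an.
  exact: val_inj aa'.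
Qed.

End necessity.

(** * Closed spans in spaces of bounded functions *)

Section closed_span.
Variables (R : realType) (J G : Type) (E : G -> J -> R^o).

(** Uniform limits of linear combinations, restricted to bounded functions so
    that the supremum norm makes sense without assuming that the [E g] are
    bounded. *)
Definition in_closed_span (x : J -> R^o) : Prop :=
  (exists M : R, forall j, `|x j| <= M) /\
  (forall e : R, 0 < e ->
     exists2 y, lin_span (range E) y & forall j, `|x j - y j| <= e).

Definition closed_span_pred : {pred (J -> R^o)} :=
  fun x => `[< in_closed_span x >].

Lemma closed_span_closed : submod_closed closed_span_pred.
Proof.
split.
  apply/asboolP; split; first by exists 0 => j; rewrite normr0.
  by move=> e e0; exists 0; [exact: lin_span0|move=> j; rewrite subrr normr0 ltW].
move=> a x y /asboolP[[M xM] xE] /asboolP[[N yN] yE]; apply/asboolP; split.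
  exists (`|a| * M + N) => j; apply: le_trans (ler_normD _ _) _.
  by rewrite lerD// normrM ler_wpM2l.
move=> e e0; have e20 : 0 < e / 2 by rewrite divr_gt0.
have a0 : 0 < `|a| + 1 by rewrite ltr_pwDr.
have [u Eu xu] := xE _ (divr_gt0 e20 a0); have [v Ev yv] := yE _ e20.
exists (a *: u + v); first by apply: lin_spanD => //; exact: lin_spanZ.
move=> j; rewrite (_ : _ - _ = a * (x j - u j) + (y j - v j)); last first.
  rewrite -[(a *: x + y) j]/(a * x j + y j) -[(a *: u + v) j]/(a * u j + v j).
  by ring.
apply: le_trans (ler_normD _ _) _; rewrite [e]splitr lerD// normrM.
apply: le_trans (_ : (`|a| + 1) * `|x j - u j| <= _).
  by rewrite ler_wpM2r// lerDl.
by rewrite mulrC -ler_pdivlMr.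
Qed.

HB.instance Definition _ := GRing.isSubmodClosed.Build R (J -> R^o)
  closed_span_pred closed_span_closed.

Record closed_span := ClosedSpan {
  span_fun :> J -> R^o;
  span_funP : span_fun \in closed_span_pred }.

HB.instance Definition _ := [isSub for span_fun].
HB.instance Definition _ := [Choice of closed_span by <:].
HB.instance Definition _ := [SubChoice_isSubLmodule of closed_span by <:].

Implicit Types x y : closed_span.

Lemma closed_spanD x y j : (x + y) j = x j + y j. Proof. by []. Qed.
Lemma closed_spanZ (a : R) x j : (a *: x) j = a * x j. Proof. by []. Qed.
Lemma closed_spanB x y j : (x - y) j = x j - y j. Proof. by []. Qed.
Lemma closed_span0 j : (0 : closed_span) j = 0. Proof. by []. Qed.

Let bounds x : set R := [set M | 0 <= M /\ forall j, `|x j| <= M].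

(** The supremum of [`|x j|], written as the least nonnegative bound so that
    an empty [J] needs no special treatment. *)
Definition sup_norm x : R := inf (bounds x).

Lemma sup_norm_le x (M : R) :
  0 <= M -> (forall j, `|x j| <= M) -> sup_norm x <= M.
Proof. by move=> M0 xM; apply: ge_inf => //; exists 0 => N []. Qed.

Let bounds_neq0 x : bounds x !=set0.
Proof.
have /asboolP[[M xM] _] := span_funP x.
exists (Num.max 0 M); split; first by rewrite le_max lexx.
by move=> j; rewrite le_max xM orbT.
Qed.

Lemma sup_norm_ge x j : `|x j| <= sup_norm x.
Proof. by apply: lb_le_inf => [|M [_]]. Qed.

Lemma sup_norm_ge0 x : 0 <= sup_norm x.
Proof. by apply: lb_le_inf => [|M []]. Qed.

Lemma sup_normD x y : sup_norm (x + y) <= sup_norm x + sup_norm y.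
Proof.
apply: sup_norm_le => [|j]; first by rewrite addr_ge0 ?sup_norm_ge0.
by apply: le_trans (ler_normD _ _) _; rewrite lerD ?sup_norm_ge.
Qed.

Let sup_normZ_le (a : R) x : sup_norm (a *: x) <= `|a| * sup_norm x.
Proof.
apply: sup_norm_le => [|j]; first by rewrite mulr_ge0 ?sup_norm_ge0.
by rewrite closed_spanZ normrM ler_wpM2l ?sup_norm_ge.
Qed.

Lemma sup_normZ (a : R) x : sup_norm (a *: x) = `|a| * sup_norm x.
Proof.
apply/eqP; rewrite eq_le sup_normZ_le /=.
have [->|a0] := eqVneq a 0; first by rewrite normr0 mul0r sup_norm_ge0.
rewrite -ler_pdivlMl ?normr_gt0// -normfV.
by apply: le_trans (sup_normZ_le _ _); rewrite scalerA mulVf// scale1r.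
Qed.

Lemma sup_norm_eq0 x : sup_norm x = 0 -> x = 0.
Proof.
move=> x0; apply: val_inj; apply/funext => j.
by apply/eqP; rewrite -normr_le0 -x0; exact: sup_norm_ge.
Qed.

HB.instance Definition _ := Lmodule_isNormed.Build R closed_span
  sup_normD sup_normZ sup_norm_eq0.

Lemma closed_span_norm_le x (M : R) : 0 <= M -> (forall j, `|x j| <= M) ->
  `|x| <= M.
Proof. exact: sup_norm_le. Qed.

Lemma closed_span_norm_ge x j : `|x j| <= `|x|.
Proof. exact: sup_norm_ge. Qed.

Lemma closed_span_complete (F : set_system closed_span) :
  ProperFilter F -> cauchy F -> cvg F.
Proof.
move=> FF Fc.
have approx (e : R) : 0 < e -> exists x, F [set y | `|x - y| < e].
  move=> e0; have [x xF] := (@cauchyP R _ F FF).1 Fc e e0; exists x.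
  by apply: filterS xF => y; rewrite -ball_normE.
have /choice[v vF] j : exists v : R, (fun x => x j : R) @ F --> v.
  apply/cvg_ex; apply: cauchy_cvg; apply: cauchy_exP => e e0.
  have [x xF] := approx e e0; exists (x j).
  apply: (@filterS _ F _ _ _ _ xF) => y /= xy; rewrite -ball_normE /=.
  by rewrite -closed_spanB; apply: le_lt_trans xy; exact: closed_span_norm_ge.
have vclose x (e : R) j : F [set y | `|x - y| < e] -> `|x j - v j| <= e.
  move=> xF; apply/ler_addgt0Pr => e' e'0.
  have vj : F [set y | `|v j - y j| < e'].
    exact: (@cvgrPdist_lt _ _ _ _ _ _ _).1 (vF j) _ e'0.
  have [y [/= xy vy]] := filter_ex (filterI xF vj).
  rewrite -(subrKA (y j)); apply: le_trans (ler_normD _ _) _; apply: lerD.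
    by rewrite -closed_spanB (le_trans (closed_span_norm_ge _ _))// ltW.
  by rewrite distrC ltW.
have vP : (v : J -> R^o) \in closed_span_pred.
  apply/asboolP; split.
    have [x xF] := approx 1 ltr01; exists (`|x| + 1) => j.
    rewrite -[v j](subrK (x j)) addrC; apply: le_trans (ler_normD _ _) _.
    rewrite lerD ?closed_span_norm_ge// distrC; exact: vclose.
  move=> e e0; have e20 : 0 < e / 2 by rewrite divr_gt0.
  have [x xF] := approx _ e20.
  have /asboolP[_ /(_ _ e20)[y Ey xy]] := span_funP x.
  exists y => // j; rewrite -(subrKA (x j)); apply: le_trans (ler_normD _ _) _.
  rewrite [e]splitr; apply: lerD; last exact: xy.
  by rewrite distrC; exact: vclose.
apply/cvg_ex; exists (ClosedSpan vP); apply/cvgrPdist_lt => e e0.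
have e30 : 0 < e / 3 by rewrite divr_gt0.
have [x xF] := approx _ e30; have xv j := vclose x _ j xF.
apply: filterS xF => y /= xy.
rewrite -(subrKA x); apply: le_lt_trans (ler_normD _ _) _.
apply: (@le_lt_trans _ _ (e / 3 + e / 3)); last by lra.
apply: lerD; last exact: ltW.
apply: closed_span_norm_le => [|j]; first exact: ltW.
by rewrite closed_spanB distrC; exact: xv.
Qed.

HB.instance Definition _ := Uniform_isComplete.Build closed_span closed_span_complete.

Lemma closed_span_le_dist x y j : `|x j - y j| <= `|x - y|.
Proof. by rewrite -closed_spanB; exact: closed_span_norm_ge. Qed.

Section evaluation.
Variable j : J.

Definition span_eval x : R^o := x j.

Let span_eval_linear : linear span_eval. Proof. by []. Qed.

HB.instance Definition _ :=
  GRing.isLinear.Build R closed_span R^o _ span_eval span_eval_linear.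

Lemma span_eval_continuous : continuous span_eval.
Proof.
apply: (@dominated_continuous _ _ _ 1) => x; rewrite mul1r.
exact: le_trans (ler_norm _) (closed_span_norm_ge x j).
Qed.

End evaluation.

Section generators.
Variable (M : R) (EM : forall g j, `|E g j| <= M).

Lemma generator_in g : E g \in closed_span_pred.
Proof.
apply/asboolP; split; first by exists M.
move=> e e0; exists (E g); first by apply: lin_span_sub; exists g.
by move=> j; rewrite subrr normr0 ltW.
Qed.

Definition generator g : closed_span := ClosedSpan (generator_in g).

Lemma generators_total x (e : R) : 0 < e ->
  exists2 y, lin_span (range generator) y & `|x - y| < e.
Proof.
move=> e0; have e20 : 0 < e / 2 by rewrite divr_gt0.
have /asboolP[_ /(_ _ e20)[u [b [l Eu]] xu]] := span_funP x.
have [y uy Ey] : exists2 y : closed_span, u = y & comb b l (fun=> range generator) y.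
  elim: l u Eu {xu} => [u ->|l IH u]; first by exists 0.
  move=> [a [_ [z [ab [g _ <-] /IH[z' -> Ez'] ->]]]].
  exists (a *: generator g + z') => //.
  by exists a, (generator g), z'; split=> //; exists g.
exists y; first by exists b, l.
apply: le_lt_trans (_ : e / 2 < e); last by rewrite ltr_pdivrMr// ltr_pMr// ltr1n.
by apply: closed_span_norm_le => [|j]; [exact: ltW|rewrite closed_spanB -uy].
Qed.

End generators.

End closed_span.

(** * The gliding hump *)

(** Schur's argument, freed from l1: [a A z] plays the part of the sum of the
    coordinates of [z] in [A].  Around a cluster point [xs] of the sequence one
    selects terms whose differences with [xs] have almost all their mass at a
    single coordinate, these coordinates [ks j] increasing rapidly.  On
    [A = range ks] all these differences have a sum bounded away from [0], while
    a cluster point of the selected terms has the same coordinates as [xs],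
    hence the same sum on [A]. *)
Section gliding_hump.
Variables (R : realType) (Z : topologicalType) (K : set Z).
Variables (a : set nat -> Z -> R) (x : nat -> Z) (eta : R).
Hypotheses (Kco : compact K) (acont : forall A, continuous (a A)).
Hypothesis aD : forall A B z, a A z = a (A `&` B) z + a (A `\` B) z.
Hypothesis atail : forall z (e : R), 0 < e ->
  exists N, forall A, (forall i, A i -> (N <= i)%N) -> `|a A z| <= e.
Hypotheses (xK : forall k, K (x k)) (eta0 : 0 < eta).

Let cluster_point (s : nat -> nat) : exists2 z, K z &
  forall (B : set Z) N, nbhs z B -> exists2 j, (N <= j)%N & B (x (s j)).
Proof.
have [|z [Kz zcl]] := Kco (F := (x \o s) @ \oo) _; first by exists 0%N => // j _; exact: xK.
exists z => // B N zB.
have Ntail : ((x \o s) @ \oo) [set y | exists2 j, (N <= j)%N & y = x (s j)].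
  by exists N => // j /= Nj; exists j.
by have [_ [[j Nj ->] Bj]] := zcl _ _ Ntail zB; exists j.
Qed.

Theorem gliding_hump : ~ forall k, eta <= `|a [set k] (x k)|.
Proof.
move=> big; have [xs _ xscl] := cluster_point id.
pose b A z := a A z - a A xs.
have bD A B z : b A z = b (A `&` B) z + b (A `\` B) z.
  by rewrite /b (aD A B z) (aD A B xs); ring.
have bcont A z (e : R) : 0 < e -> nbhs z [set y | `|b A z - b A y| < e].
  move=> e0; have zA : nbhs z [set y | `|a A z - a A y| < e].
    exact: (@cvgrPdist_lt _ _ _ _ _ _ _).1 (@acont A z) e e0.
  by apply: filterS zA => y /=; rewrite /b opprB addrA subrK.
have b_xs A : b A xs = 0 by rewrite /b subrr.
have btail z (e : R) : 0 < e ->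
    exists N, forall A, (forall i, A i -> (N <= i)%N) -> `|b A z| <= e.
  move=> e0; have e20 : 0 < e / 2 by rewrite divr_gt0.
  have [N NP] := atail z e20; have [N' N'P] := atail xs e20.
  exists (maxn N N') => A AN; apply: le_trans (ler_normB _ _) _.
  by rewrite [e]splitr lerD//; [apply: NP|apply: N'P] => i /AN;
    rewrite geq_max => /andP[].
have b0 z : b set0 z = 0.
  by have /eqP := bD set0 set0 z; rewrite set0I setD0 -subr_eq0 opprD addNKr oppr_eq0 => /eqP.
have bhead N (d : R) z : 0 <= d -> (forall i, (i < N)%N -> `|b [set i] z| <= d) ->
    forall A, (forall i, A i -> (i < N)%N) -> `|b A z| <= N%:R * d.
  move=> d0; elim: N => [|N IH] bi A AN.
    rewrite mul0r (_ : A = set0) ?b0 ?normr0//.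
    by apply/seteqP; split=> // i /AN.
  rewrite (bD A `I_N) -natr1 mulrDl mul1r; apply: le_trans (ler_normD _ _) _.
  apply: lerD.
    by apply: IH => [i iN|i []//]; apply: bi; exact: ltnW.
  case: (pselect (A N)) => [AN'|nAN].
    rewrite (_ : _ `\` _ = [set N]); first exact: bi.
    apply/seteqP; split=> [i [/AN + /negP] /=|i -> /=]; last by rewrite ltnn.
    by rewrite ltnS -leqNgt => ? ?; apply/eqP; rewrite eqn_leq; apply/andP.
  rewrite (_ : _ `\` _ = set0) ?b0 ?normr0//.
  apply/seteqP; split=> // i [Ai /negP /=]; rewrite -leqNgt => Ni; apply: nAN.
  by rewrite (_ : N = i)//; apply/eqP; rewrite eqn_leq Ni -ltnS AN.
have [k0 k0P] : exists k0, forall k, (k0 <= k)%N -> eta / 2 <= `|b [set k] (x k)|.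
  have eta20 : 0 < eta / 2 by rewrite divr_gt0.
  have [k0 k0P] := atail xs eta20; exists k0 => k kk0.
  have : `|a [set k] xs| <= eta / 2 by apply: k0P => i ->.
  have := big k; have := lerB_dist (a [set k] (x k)) (a [set k] xs).
  by rewrite -/(b [set k] (x k)); lra.
have eta80 : 0 < eta / 8 by rewrite divr_gt0.
(* [N] coordinates bounded by [dl N] add up to at most [eta / 8], and [dl N]
   tends to [0], so that the selected coordinates converge to those of [xs] *)
pose dl (N : nat) : R := eta / 8 / N.+1%:R.
have dl0 N : 0 < dl N by rewrite divr_gt0.
(* next term [p.1] after [N]: nothing before [N], almost nothing from [p.2] on *)
have /choice[nxt nxtP] N : exists p : nat * nat, [/\ (N <= p.1 < p.2)%N,
    (forall i, (i < N)%N -> `|b [set i] (x p.1)| <= dl N) &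
    forall A, (forall i, A i -> (p.2 <= i)%N) -> `|b A (x p.1)| <= eta / 8].
  have nb M : (M <= N)%N -> nbhs xs [set y | forall i, (i < M)%N -> `|b [set i] y| <= dl N].
    elim: M => [_|M IH MN]; first exact: nearW.
    apply: filterS (filterI (IH (ltnW MN)) (bcont [set M] xs _ (dl0 N))).
    move=> y [/= yM]; rewrite b_xs sub0r normrN => /ltW yMN i.
    by rewrite ltnS leq_eqVlt => /predU1P[->//|/yM].
  have [k Nk kP] := xscl _ N (nb N (leqnn N)).
  have [N' N'P] := btail (x k) _ eta80.
  exists (k, (maxn N' k.+1)); split=> //=.
    by rewrite Nk leq_maxr.
  by move=> A AN; apply: N'P => i /AN; apply: leq_trans; rewrite leq_maxl.
pose Ns j := iter j (fun N => (nxt N).2) k0.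
pose ks j := (nxt (Ns j)).1.
have NkN j : (Ns j <= ks j < Ns j.+1)%N by have [] := nxtP (Ns j).
have NsS j : (Ns j < Ns j.+1)%N by have /andP[/leq_ltn_trans] := NkN j; apply.
have Ns_mono i j : (i <= j)%N -> (Ns i <= Ns j)%N.
  move=> /subnK <-; elim: (j - i)%N => [//|m IH].
  by apply: leq_trans IH _; rewrite addSn ltnW.
have Ns_ge j : (j <= Ns j)%N.
  by elim: j => // j IH; apply: leq_ltn_trans IH (NsS j).
have k0Ns j : (k0 <= Ns j)%N by exact: (Ns_mono 0%N).
pose A := range ks.
have hump j : eta / 4 <= `|b A (x (ks j))|.
  have [_ head tail] := nxtP (Ns j).
  rewrite (bD A `I_(Ns j)) (bD (A `\` _) [set ks j]).
  set u := b _ _; set v := b _ _; set w := b _ _.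
  have u8 : `|u| <= eta / 8.
    apply: le_trans (bhead (Ns j) (dl (Ns j)) _ (ltW (dl0 _)) head _ _) _.
      by move=> i [].
    by rewrite /dl mulrCA ger_pMr// ler_pdivrMr ?ltr0n// mul1r ler_nat.
  have vE : eta / 2 <= `|v|.
    rewrite /v (_ : _ `&` _ = [set ks j]); last first.
      apply/seteqP; split=> [i []//|_ ->]; split=> //; split; first by exists j.
      by move=> /=; apply/negP; rewrite -leqNgt; have /andP[] := NkN j.
    by apply: k0P; apply: leq_trans (k0Ns j) _; have /andP[] := NkN j.
  have w8 : `|w| <= eta / 8.
    apply: tail => _ [[[i _ <-] /negP /=]]; rewrite -leqNgt => ji.
    have [ij|ij] := leqP i j; last first.
      move=> _; apply: leq_trans (Ns_mono _ _ ij) _; by have /andP[] := NkN i.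
    move: ij; rewrite leq_eqVlt => /predU1P[->//|ij].
    have /andP[_ /leq_trans /(_ (Ns_mono _ _ ij))] := NkN i.
    by rewrite ltnNge ji.
  have := lerB_normD v (u + w).
  have := ler_normD u w.
  rewrite (_ : u + (v + w) = v + (u + w)); last by ring.
  by lra.
have [z _ zcl] := cluster_point ks.
have bz i : b [set i] z = 0.
  apply/eqP; rewrite -normr_le0; apply/ler_addgt0Pr => e e0; rewrite add0r.
  have e20 : 0 < e / 2 by rewrite divr_gt0.
  have dle : 0 < e / 2 / (eta / 8) by rewrite divr_gt0.
  have [n _ /(_ n (leqnn _)) /= nP] := near_infty_natSinv_lt (PosNum dle).
  have [j] := zcl _ (maxn i.+1 n) (bcont [set i] z _ e20).
  rewrite geq_max => /andP[ij nj] /= bij.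
  have [_ /(_ i (leq_trans ij (Ns_ge j))) bi _] := nxtP (Ns j).
  have dlj : dl (Ns j) <= e / 2.
    rewrite /dl mulrC -ler_pdivlMr//; apply: le_trans (ltW nP).
    by rewrite lef_pV2 ?posrE ?ltr0n// ler_nat ltnS (leq_trans nj).
  have := ler_normD (b [set i] z - b [set i] (x (ks j))) (b [set i] (x (ks j))).
  rewrite subrK; move: bij bi dlj; rewrite -/(ks j); lra.
have bAz : b A z = 0.
  apply/eqP; rewrite -normr_le0; apply/ler_addgt0Pr => e e0; rewrite add0r.
  have [N NP] := btail z e e0.
  rewrite (bD A `I_N); apply: le_trans (ler_normD _ _) _.
  rewrite -[leRHS]add0r; apply: lerD.
    have := bhead N 0 z (lexx _) _ (A `&` `I_N); rewrite mulr0; apply=> i.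
      by rewrite bz normr0.
    by case.
  by apply: NP => i [_ /negP]; rewrite /= -leqNgt.
have eta40 : 0 < eta / 4 by rewrite divr_gt0.
have [j _ /=] := zcl _ 0%N (bcont A z _ eta40).
rewrite bAz sub0r normrN; apply/negP; rewrite -leNgt; exact: hump.
Qed.

End gliding_hump.

(** * The space of a pair of labellings *)

Lemma ultra_finite (T Q : Type) (U : set_system T) (B : set Q)
    (r : T -> Q -> Prop) :
  UltraFilter U -> finite_set B -> U [set t | exists2 q, B q & r t q] ->
  exists q, U [set t | r t q].
Proof.
elim/Pchoice: Q B r => Q B r UU /finite_setP[n]; elim: n B => [|n IH] B.
  rewrite II0 card_eq0 => /eqP -> U0.
  by have [t [q []]] := filter_ex U0.
move=> /eq_cardSP[q Bq /IH{}IH] UB.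
have [Uq|Unq] := in_ultra_setVsetC [set t | r t q] UU; first by exists q.
apply: IH; apply: filterS (filterI UB Unq) => t [[q' Bq' rtq'] nrtq].
by exists q' => //; split=> // q'q; apply: nrtq; rewrite -q'q.
Qed.

(** Greedy choice avoiding the finite list of the previous values. *)
Lemma distinct_representatives (T : Type) (V : nat -> set T) :
  (forall k, infinite_set (V k)) ->
  exists v : nat -> T, injective v /\ forall k, V k (v k).
Proof.
elim/Pchoice: T V => T V Vinf.
have /choice[pick pickP] (p : nat * seq T) : exists x, V p.1 x /\ x \notin p.2.
  apply: contrapT => /forallNP H; apply: (Vinf p.1).
  apply: (@sub_finite_set _ _ [set` p.2]); last exact: finite_seq.
  by move=> x Vx /=; apply/negPn/negP => xp; apply: (H x).
pose fix prev k := if k is k'.+1 then pick (k', prev k') :: prev k' else [::].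
have prev_mem i k : (i < k)%N -> pick (i, prev i) \in prev k.
  elim: k => // k IH; rewrite ltnS leq_eqVlt inE => /predU1P[->|/IH ->].
    by rewrite eqxx.
  by rewrite orbT.
exists (fun k => pick (k, prev k)); split=> [i k|k]; last by have [] := pickP (k, prev k).
have neq m n : (m < n)%N -> pick (m, prev m) != pick (n, prev n).
  move=> mn; apply/eqP => e; have [_ /negP] := pickP (n, prev n).
  by rewrite -e; apply; exact: prev_mem.
move=> e; have [ik|ki|//] := ltngtP i k.
  by have := neq _ _ ik; rewrite e eqxx.
by have := neq _ _ ki; rewrite e eqxx.
Qed.

Section generators_vanish.
Variables (R : realType) (J G : Type) (E : G -> J -> R^o) (M : R).
Hypothesis EM : forall g j, `|E g j| <= M.
Local Notation X := (closed_span E).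

Lemma generators_vanish (h : X -> R) (C : R) :
    (forall x y, h (x + y) = h x + h y) ->
    (forall (a : R) x, h (a *: x) = a * h x) ->
    (forall x, `|h x| <= C * `|x|) -> (forall g, h (generator EM g) = 0) ->
  forall x, h x = 0.
Proof.
move=> hD hZ hC hE x.
have hspan y : lin_span (range (generator EM)) y -> h y = 0.
  move=> [b [l]]; elim: l y => [y ->|l IH y [a [_ [z [_ [g _ <-] /IH hz ->]]]]].
    by rewrite -(scale0r (0 : X)) hZ mul0r.
  by rewrite hD hZ hE hz mulr0 addr0.
apply/eqP; rewrite -normr_le0; apply/ler_addgt0Pr => e e0; rewrite add0r.
have C0 : 0 < `|C| + 1 by rewrite ltr_pwDr.
have [y /hspan hy xy] := generators_total EM x (divr_gt0 e0 C0).
rewrite -[x](subrK y) hD hy addr0; apply: le_trans (hC _) _.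
apply: (@le_trans _ _ ((`|C| + 1) * `|x - y|)).
  by rewrite ler_wpM2r// (le_trans (ler_norm _))// lerDl.
by rewrite mulrC -ler_pdivlMr// ltW.
Qed.

End generators_vanish.

Lemma sum_at_most_one (R : realType) m (F : 'I_m -> R) :
  (forall k, `|F k| <= 1) -> (forall k l, F k != 0 -> F l != 0 -> k = l) ->
  `|\sum_(k < m) F k| <= 1.
Proof.
move=> F1 Funiq; have [[k Fk]|F0] := pselect (exists k, F k != 0).
  rewrite (bigD1 k)//= big1 ?addr0// => l lk; apply/eqP/negPn/negP => Fl.
  by move: lk; rewrite (Funiq _ _ Fl Fk) eqxx.
rewrite big1 ?normr0// => k _; apply/eqP/negPn/negP => Fk; apply: F0.
by exists k.
Qed.

Section dispersed_space.
Variables (R : realType) (G tau kappa : Type).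
Variables (c : G -> tau) (g : G -> nat -> kappa).

Definition dispersed (n : nat) (D : set G) : Prop :=
  forall a b, D a -> D b -> a <> b -> c a <> c b /\ g a n <> g b n.

Lemma dispersedS n (D D' : set G) :
  D' `<=` D -> dispersed n D -> dispersed n D'.
Proof. by move=> DD' Dn a b /DD' ? /DD' ?; exact: Dn. Qed.

Lemma dispersed1 n a : dispersed n [set a].
Proof. by move=> _ _ -> ->. Qed.

(** These weights tend to [0]: in [functional_small] only finitely many levels
    [n] can then oppose the smallness of long sums. *)
Definition weight (n : nat) : R := n.+1%:R^-1.

Lemma weight_gt0 n : 0 < weight n. Proof. by rewrite invr_gt0. Qed.

Lemma weight_le1 n : weight n <= 1.
Proof. by rewrite invf_le1// ler1n. Qed.

Definition dispersed_fun (a : G) (j : nat * set G) : R^o :=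
  if pselect (dispersed j.1 j.2 /\ j.2 a) then weight j.1 else 0.

Lemma dispersed_fun_in a n D :
  dispersed n D -> D a -> dispersed_fun a (n, D) = weight n.
Proof. by move=> Dn Da; rewrite /dispersed_fun; case: pselect => //= -[]. Qed.

Lemma dispersed_fun_out a n D : ~ D a -> dispersed_fun a (n, D) = 0.
Proof. by move=> nDa; rewrite /dispersed_fun; case: pselect => //= -[]. Qed.

Lemma dispersed_fun_le a j : `|dispersed_fun a j| <= weight j.1.
Proof.
rewrite /dispersed_fun; case: pselect => [?|?]; last by rewrite normr0 ltW// weight_gt0.
by rewrite gtr0_norm// weight_gt0.
Qed.

Lemma dispersed_fun_le1 a j : `|dispersed_fun a j| <= 1.
Proof. exact: le_trans (dispersed_fun_le a j) (weight_le1 _). Qed.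

Definition dispersed_space := closed_span dispersed_fun.
Local Notation X := (dispersed_space : completeNormedModType R).
Local Notation W := (weak_space dispersed_space).
Notation e_ := (generator dispersed_fun_le1).
Implicit Types (x y : dispersed_space) (D S : set G).

Lemma unit_vectorE a j : e_ a j = dispersed_fun a j. Proof. by []. Qed.

Lemma unit_vector_norm a : `|e_ a| <= 1.
Proof. by apply: closed_span_norm_le => // j; exact: dispersed_fun_le1. Qed.

Lemma unit_vector1 a : e_ a (0%N, [set a]) = 1.
Proof.
by rewrite unit_vectorE dispersed_fun_in//; [rewrite /weight invr1|exact: dispersed1].
Qed.

Lemma unit_vector_inj : injective e_.
Proof.
move=> a b ab; apply: contrapT => nab; have := unit_vector1 a.
rewrite ab unit_vectorE dispersed_fun_out//; last by move=> /esym.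
by move=> /eqP; rewrite eq_sym oner_eq0.
Qed.

Lemma unit_vector_neq0 a : e_ a <> 0.
Proof.
move=> a0; have := unit_vector1 a; rewrite a0 closed_span0 => /eqP.
by rewrite eq_sym oner_eq0.
Qed.

(** Immediate for linear combinations of unit vectors, hence in the closure.  It
    says that the series of coordinates along a dispersed set converges. *)
Lemma eval_tail x (e : R) : 0 < e -> exists2 F : set G, finite_set F &
  forall n D, (forall a, F a -> ~ D a) -> `|x (n, D)| <= e.
Proof.
move=> e0; have [y [b [l Ey]] xy] := generators_total dispersed_fun_le1 x e0.
have [F Ffin Fy] : exists2 F : set G, finite_set F &
    forall n D, (forall a, F a -> ~ D a) -> y (n, D) = 0.
  elim: l y Ey {xy} => [y ->|l IH y [r [_ [z [_ [a _ <-] /IH[F Ffin Fz] ->]]]]].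
    by exists set0.
  exists (a |` F); first by rewrite finite_setU; split; first exact: finite_set1.
  move=> n D FD; rewrite closed_spanD closed_spanZ Fz => [|a' Fa'].
    by rewrite unit_vectorE dispersed_fun_out ?mulr0 ?addr0//; apply: FD; left.
  by apply: FD; right.
exists F => // n D FD; have := closed_span_le_dist x y (n, D).
by rewrite Fy// subr0 => /le_trans; apply; exact: ltW.
Qed.

Lemma eval_split n D S x : dispersed n D ->
  x (n, D) = x (n, D `&` S) + x (n, D `\` S).
Proof.
move=> Dn; apply/eqP; rewrite -subr_eq0 opprD addrA; apply/eqP.
pose h y : R := y (n, D) - y (n, D `&` S) - y (n, D `\` S).
apply: (@generators_vanish _ _ _ _ _ dispersed_fun_le1 h 3).
- by move=> y z; rewrite /h !closed_spanD; ring.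
- by move=> r y; rewrite /h !closed_spanZ; ring.
- move=> y; rewrite (_ : 3 * `|y| = `|y| + `|y| + `|y|); last by ring.
  apply: le_trans (ler_normB _ _) _; apply: lerD; last exact: closed_span_norm_ge.
  by apply: le_trans (ler_normB _ _) _; apply: lerD; exact: closed_span_norm_ge.
- move=> a; rewrite /h !unit_vectorE.
  have [Da|nDa] := pselect (D a); last first.
    by rewrite !dispersed_fun_out ?subr0// => -[].
  have [Sa|nSa] := pselect (S a).
    rewrite [X in _ - X]dispersed_fun_out; last by case.
    rewrite subr0 !dispersed_fun_in ?subrr//.
    by apply: dispersedS Dn => ? [].
  rewrite [X in _ - X - _]dispersed_fun_out; last by case.
  rewrite subr0 !dispersed_fun_in ?subrr//.
  by apply: dispersedS Dn => ? [].
Qed.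

Lemma eval1 n a x : x (n, [set a]) = weight n * x (0%N, [set a]).
Proof.
apply/eqP; rewrite -subr_eq0; apply/eqP.
pose h y : R := y (n, [set a]) - weight n * y (0%N, [set a]).
apply: (@generators_vanish _ _ _ _ _ dispersed_fun_le1 h 2).
- by move=> y z; rewrite /h !closed_spanD; ring.
- by move=> r y; rewrite /h !closed_spanZ; ring.
- move=> y; rewrite (_ : 2 * `|y| = `|y| + `|y|); last by ring.
  apply: le_trans (ler_normB _ _) _; apply: lerD; first exact: closed_span_norm_ge.
  rewrite normrM gtr0_norm ?weight_gt0// -[leRHS]mul1r.
  apply: ler_pM => //; first exact/ltW/weight_gt0.
    exact: weight_le1.
  exact: closed_span_norm_ge.
- move=> b; rewrite /h !unit_vectorE.
  have [->|ba] := pselect (b = a).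
    by rewrite !dispersed_fun_in//; rewrite /weight; try exact: dispersed1; rewrite invr1 mulr1 subrr.
  by rewrite !dispersed_fun_out// mulr0 subrr.
Qed.

(** If [f] were at least [e] in absolute value on [m] unit vectors indexed by
    [S], their signed sum [y] would satisfy [m * e <= f y <= C * `|y|].  At the
    levels [n < N] a dispersed set sees at most one of the vectors, and at the
    others the weights are small, so [`|y| <= 1 + m * weight N] with
    [weight N < e / (2 * C)]; this bounds [m]. *)
Lemma functional_small (f : {linear dispersed_space -> R^o}) (e : R) :
  continuous f -> 0 < e ->
  exists N, forall S, (forall n, (n < N)%N -> forall a b, S a -> S b ->
      c a = c b \/ g a n = g b n) ->
    finite_set [set a | S a /\ e <= `|f (e_ a)|].
Proof.
move=> fc e0; have [C C0 fC] := continuous_dominated fc.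
have eC0 : 0 < e / 2 / C by rewrite !divr_gt0.
have [N _ /(_ N (leqnn _)) /= NP] := near_infty_natSinv_lt (PosNum eC0).
exists N => S SP; apply: contrapT => Tinf.
have [a0 _] := infinite_setN0 Tinf.
have /(card_le_setP a0)[i [iT iI]] := (infiniteP _).1 Tinf.
pose m := (Num.truncn (2 * C / e)).+1.
have mC : 2 * C / e < m%:R by exact: truncnS_gt.
pose y : dispersed_space := \sum_(k < m) Num.sg (f (e_ (i k))) *: e_ (i k).
have fy : m%:R * e <= f y.
  rewrite linear_sum /= mulr_natl -[m in _ *+ m]card_ord -sumr_const.
  apply: ler_sum => k _; rewrite linearZ /=.
  rewrite -[leRHS]/(Num.sg (f (e_ (i k))) * f (e_ (i k))) -normrEsg.
  exact: (iT k I).2.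
have yj j : y j = \sum_(k < m) (Num.sg (f (e_ (i k))) * dispersed_fun (i k) j).
  by rewrite -[y j]/(span_eval j y) linear_sum.
have sg1 (r : R) : `|Num.sg r| <= 1 by rewrite normr_sg; case: (r != 0); rewrite ?ler01.
have ynorm : `|y| <= 1 + m%:R * weight N.
  apply: closed_span_norm_le; first by rewrite addr_ge0// mulr_ge0// ltW// weight_gt0.
  move=> [n D]; rewrite yj; have [nN|Nn] := ltnP n N.
    apply: (@le_trans _ _ 1); last first.
      by rewrite lerDl mulr_ge0// ltW// weight_gt0.
    apply: sum_at_most_one => [k|k l].
      by rewrite normrM mulr_ile1// dispersed_fun_le1.
    have nz (r s : R) : r * s != 0 -> s != 0 by rewrite mulf_eq0 negb_or => /andP[].
    move=> /nz + /nz.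
    rewrite /dispersed_fun; case: pselect => /= [[Dn Dk] _|_]; last by rewrite eqxx.
    case: pselect => /= [[_ Dl] _|_]; last by rewrite eqxx.
    apply/val_inj/iI => //; apply: contrapT => kl.
    have [cn gn] := Dn _ _ Dk Dl kl.
    by have [] := SP n nN _ _ (iT k I).1 (iT l I).1.
  apply: (@le_trans _ _ (m%:R * weight N)); last by rewrite lerDr.
  apply: le_trans (ler_norm_sum _ _ _) _.
  rewrite mulr_natl -[m in _ *+ m]card_ord -sumr_const; apply: ler_sum => k _.
  rewrite normrM -[leRHS]mul1r; apply: ler_pM => //.
  apply: le_trans (dispersed_fun_le _ _) _.
  by rewrite lef_pV2 ?posrE ?ltr0n// ler_nat.
have := le_trans fy (le_trans (ler_norm _) (fC y)).
apply/negP; rewrite -ltNge.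
apply: (@le_lt_trans _ _ (C * (1 + m%:R * weight N))); first by rewrite ler_pM2l.
move: mC NP; rewrite ltr_pdivrMr// ltr_pdivlMr// => mC NP.
have m0 : 0 < m%:R :> R by rewrite ltr0n.
have : m%:R * (weight N * C) <= m%:R * (e / 2) by rewrite ler_pM2l// ltW.
rewrite mulrDr mulr1 [C * _]mulrC -mulrA => ?; lra.
Qed.

(** Along an ultrafilter, either a single unit vector occurs almost everywhere,
    or the finite exceptional sets of [functional_small] are avoided and the
    unit vectors tend weakly to [0]. *)
Lemma ultra_unit_vectors (T : Type) (U : set_system T) (z : T -> W)
    (S : nat -> set G) :
    UltraFilter U ->
    (forall N, U [set t | z t = 0 \/ exists2 a, S N a & z t = e_ a]) ->
    (forall N n, (n < N)%N -> forall a b, S N a -> S N b ->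
      c a = c b \/ g a n = g b n) ->
  (exists a, U [set t | z t = e_ a]) \/ z @ U --> (0 : W).
Proof.
move=> UU US SP; have [Ua|nUa] := pselect (exists a, U [set t | z t = e_ a]).
  by left.
right; apply/(@weak_cvg_fmapP R X) => f fc; apply/cvgrPdist_lt => e e0.
have [//|Ube] := in_ultra_setVsetC [set t | `|f 0 - f (z t)| < e] UU.
have [N NP] := functional_small fc e0.
case: nUa; apply: (ultra_finite UU (NP (S N) (SP N))).
apply: filterS (filterI (US N) Ube) => t [[zt|[a Sa zt]]] /=; rewrite zt.
  by rewrite subrr normr0.
rewrite linear0 sub0r normrN => /negP; rewrite -leNgt => fe; by exists a.
Qed.

Lemma unit_vector_cvg (T : Type) (U : set_system T) (z : T -> W) (x : W) :
  Filter U -> U [set t | z t = x] -> z @ U --> x.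
Proof.
move=> UF Ux A xA; apply: (@filterS _ U _ _ _ _ Ux) => t /= ->.
exact: nbhs_singleton.
Qed.

Definition column (t : tau) : set W :=
  [set x | x = 0 \/ exists2 a, c a = t & x = e_ a].

Lemma column_compact t : compact (column t).
Proof.
rewrite compact_ultra => U UU Ut.
have [||[a Ua]|U0] := @ultra_unit_vectors W U id (fun=> [set a | c a = t]) UU.
- by [].
- by move=> _ n _ a b <- <-; left.
- exists (e_ a); split; last exact: (@unit_vector_cvg W U id).
  by have [x [tx /= <-]] := filter_ex (filterI Ut Ua).
- by exists 0; split; [left|].
Qed.

Definition fibre (s : nat -> kappa) : set W :=
  [set x | x = 0 \/ exists2 a, g a = s & x = e_ a].

Lemma fibre_usco : seq_usco fibre.
Proof.
move=> U s0 UU Us Us0.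
have [|||] := @ultra_unit_vectors _ U snd
    (fun N => [set a | forall n, (n < N)%N -> g a n = s0 n]) UU.
- elim=> [|N IH].
    by apply: filterS Us => p [p0|[a _ pa]]; [left|right; exists a].
  apply: filterS (filterI Us (filterI IH (Us0 N))) => p [].
  move=> [p0|[a ap pa]] [[pz|[b bN pb]] /= pN];
    [by left|by left|by left|right].
  exists a => // n; rewrite ltnS leq_eqVlt => /predU1P[->|]; first by rewrite ap.
  have /unit_vector_inj <- : e_ b = e_ a by rewrite -pa -pb.
  exact: bN.
- by move=> N n nN a b aN bN; right; rewrite aN// bN.
- move=> [a Ua]; exists (e_ a); last exact: (@unit_vector_cvg _ U snd).
  right; exists a => //; apply/funext => n.
  have [p [[/= + pa] pn]] := filter_ex (filterI (filterI Us Ua) (Us0 n)).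
  rewrite pa => -[/unit_vector_neq0//|[b bp /unit_vector_inj ->]].
  by rewrite bp.
- by move=> U0; exists 0 => //; left.
Qed.

Lemma unit_vectors_total x (e : R) (D : set W) : 0 < e ->
  (forall a, D (e_ a)) -> exists2 y, lin_span (D : set X) y & `|x - y| < e.
Proof.
move=> e0 De; have [y [b [l Ey]] xy] := generators_total dispersed_fun_le1 x e0.
exists y => //; exists b, l; apply: comb_mono Ey => // i _ _ [a _ <-].
exact: De.
Qed.

Lemma dispersed_space_lK_le (kappa_inf : infinite_set [set: kappa]) :
  exists M : completeMetricType R, is_weight M kappa /\
    exists phi : M -> set W, usco phi.
Proof.
have [|psi upsi psicov] := @seq_usco_generate R X kappa fibre kappa_inf fibre_usco.
  move=> x e e0; apply: unit_vectors_total => // a.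
  by exists (g a) => //; right; exists a.
exact: seq_usco_metric kappa_inf upsi psicov.
Qed.

Lemma dispersed_space_CG_le (tau_inf : infinite_set [set: tau]) :
  exists C : tau -> set W, (forall t, compact (C t)) /\ dense (\bigcup_t C t).
Proof.
apply: (@compact_generate R X tau column tau_inf column_compact).
move=> x e e0; apply: unit_vectors_total => // a.
by exists (c a) => //; right; exists a.
Qed.

(** The unit vectors of [B] form a weakly closed discrete set: evaluation at
    [(0, B minus a finite set)] is small at a given point by [eval_tail], but
    equals [1] at all but finitely many of them.  Hence every point of [M] has a
    neighbourhood whose values contain finitely many of them, and a basis of [M]
    has at least as many elements as [B]. *)
Lemma usco_weight_ge (B : set G) (M : completeMetricType R) (L : Type)
    (phi : M -> set W) (V : set (set M)) :
  dispersed 0 B -> infinite_set [set: L] -> basis V -> V #= [set: L] ->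
  usco phi ->
  [set: {a | B a}] #<= [set: L].
Proof.
move=> Bdisp Linf [Vop Vb] VL uphi.
have small (m : M) : exists2 N : set M, nbhs m N &
    finite_set [set a | B a /\ exists2 m', N m' & phi m' (e_ a)].
  apply: contrapT => nsmall.
  have Ninf (N : set M) : nbhs m N ->
      infinite_set [set a | B a /\ exists2 m', N m' & phi m' (e_ a)].
    by move=> mN Nfin; apply: nsmall; exists N.
  (* pairs in the graph, near [m], whose value is a unit vector of [B] outside a
     given finite set *)
  pose F := filter_from [set q : set M * set G | nbhs m q.1 /\ finite_set q.2]
    (fun q => [set p : M * W | exists a, [/\ B a, ~ q.2 a, q.1 p.1, phi p.1 p.2 &
      p.2 = e_ a]]).
  have FP : ProperFilter F.
    apply: filter_from_proper; last first.
      move=> [N A] [/= mN Afin].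
      have [a [[Ba [m' Nm' ma]] nAa]] := infinite_setN0 (infinite_setD (Ninf N mN) Afin).
      by exists (m', e_ a), a.
    apply: filter_from_filter.
      by exists (setT, set0); split; [exact: filterT|exact: finite_set0].
    move=> [N1 A1] [N2 A2] [/= n1 f1] [/= n2 f2]; exists (N1 `&` N2, A1 `|` A2).
      by split; [exact: filterI|rewrite finite_setU].
    move=> p [a [Ba nA [N1p N2p] pp pa]].
    by split; exists a; split=> // Aa; apply: nA; [left|right].
  have [U [UU FU]] := ultraFilterLemma FP.
  have Usub (N : set M) (A : set G) : nbhs m N -> finite_set A ->
      U [set p : M * W | exists a, [/\ B a, ~ A a, N p.1, phi p.1 p.2 & p.2 = e_ a]].
    by move=> mN Afin; apply: FU; exists (N, A).
  have [||z mz Uz] := usco_ultra uphi UU (m0 := m).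
  - apply: filterS (Usub setT set0 filterT (finite_set0 _)) => p.
    by move=> [a []].
  - move=> N mN; apply: (@filterS _ U _ _ _ _ (Usub N set0 mN (finite_set0 _))).
    by move=> p [a []].
  have half0 : 0 < 2^-1 :> R by rewrite invr_gt0.
  have [A Afin Atail] := eval_tail (z : dispersed_space) half0.
  have zA := Atail 0%N (B `\` A) (fun a Aa => fun BA => BA.2 Aa).
  have Uz1 : U [set p : M * W | `|(z : dispersed_space) (0%N, B `\` A) -
      (p.2 : dispersed_space) (0%N, B `\` A)| < 2^-1].
    exact: Uz (weak_nbhs z (@span_eval_continuous _ _ _ dispersed_fun (0%N, B `\` A)) half0).
  have [p [/= zp [a [Ba nAa _ _ pa]]]] := filter_ex (filterI Uz1
    (Usub setT A filterT Afin)).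
  move: zp; rewrite pa unit_vectorE dispersed_fun_in; first last.
  - by [].
  - by apply: dispersedS Bdisp => ? [].
  have := ler_normB ((z : dispersed_space) (0%N, B `\` A) - 1) ((z : dispersed_space) (0%N, B `\` A)).
  rewrite addrAC subrr add0r normrN normr1 /weight invr1; lra.
have [m0 _ _] : exists2 m : M, True & True by exists point.
have [l0 _] := infinite_setN0 Linf.
have /(card_le_setP l0)[code [_ codeI]] : V #<= [set: L] by case/card_eqPle : VL.
pose T (N : set M) := [set a | B a /\ exists2 m', N m' & phi m' (e_ a)].
apply: (@card_le_finite_cover _ _ (fun l => [set a : {a | B a} |
  exists b, [/\ V b, code b = l, finite_set (T b) & T b (sval a)]])) => // [l|[a Ba]].
  have [[b [Vb' bl]]|nb] := pselect (exists b, V b /\ code b = l).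
    have [Tfin|Tinf] := pselect (finite_set (T b)).
      apply: (@sub_finite_set _ _ (sval @^-1` (T b))).
        by move=> a [b' [Vb'' b'l _ Ta]] /=; rewrite -(codeI b' b)// b'l.
      apply: finite_preimage => // a a' _ _ aa'.
      by apply: eq_sig_hprop => // ? ? ?; exact: Prop_irrelevance.
    rewrite (_ : [set a | _] = set0)//; apply/seteqP; split=> // a [b' [Vb'' b'l Tfin _]].
    by apply: Tinf; rewrite -(codeI b' b)// b'l.
  rewrite (_ : [set a | _] = set0)//; apply/seteqP; split=> // a [b [Vb' bl _ _]].
  by apply: nb; exists b.
have [_ _ phicov] := uphi.
have [m _ ma] : (\bigcup_m phi m) (e_ a) by rewrite phicov.
have [N mN Nfin] := small m; have [b [Vb' bm] bN] := Vb m N mN.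
exists (code b), b; split=> //=.
  apply: sub_finite_set Nfin => a' [Ba' [m' bm' m'a]].
  by split=> //; exists m' => //; exact: bN.
by split=> //; exists m.
Qed.

(** [gliding_hump] for the evaluations at [(n, d @` A)], which are additive in [A]
    because subsets of dispersed sets are dispersed. *)
Lemma compact_no_dispersed_sequence (K : set W) n (d : nat -> G) (e : R) :
  compact K -> injective d -> dispersed n (range d) -> 0 < e ->
  ~ (forall k, exists2 x : dispersed_space, K x & e <= `|x (0%N, [set d k])|).
Proof.
move=> Kco dI ddisp e0 big.
have /choice[x xP] k : exists x : dispersed_space, K x /\ e <= `|x (0%N, [set d k])|.
  by have [x Kx ex] := big k; exists x.
have dS (A : set nat) : dispersed n (d @` A) by apply: dispersedS ddisp; exact: image_subset.
apply: (@gliding_hump R W K (fun A (x : dispersed_space) => x (n, d @` A)) x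
  (weight n * e) Kco) => //.
- move=> A; apply/continuousP => B Bop.
  exact: (weak_open (@span_eval_continuous _ _ _ dispersed_fun (n, d @` A)) Bop).
- move=> A B y; rewrite (eval_split (d @` B) y (dS A)).
  rewrite (_ : _ `&` _ = d @` (A `&` B)); last first.
    apply/seteqP; split=> [_ [[i Ai <-] [j Bj /dI ji]]|_ [i [Ai Bi] <-]].
      by exists i => //; split=> //; rewrite -ji.
    by split; exists i.
  rewrite (_ : _ `\` _ = d @` (A `\` B))//.
  apply/seteqP; split=> [_ [[i Ai <-] nB]|_ [i [Ai nBi] <-]].
    by exists i => //; split=> // Bi; apply: nB; exists i.
  by split; [exists i|move=> [j Bj /dI ji]; apply: nBi; rewrite -ji].
- move=> y r r0; have [F Ffin Ftail] := eval_tail (y : dispersed_space) r0.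
  have [N NP] : exists N, forall i, F (d i) -> (i < N)%N.
    have : finite_set (d @^-1` F) by apply: finite_preimage => // i j _ _ /dI.
    move=> /finite_seqP[D DE]; exists (\max_(i <- D) i).+1 => i Fi.
    have iD : i \in D by have : (d @^-1` F) i by []; rewrite DE.
    by rewrite ltnS; apply: (leq_bigmax_seq (F := id)).
  exists N => A AN; apply: Ftail => a Fa [i Ai ia].
  by have := AN i Ai; rewrite leqNgt NP// ia.
- by move=> k; exact: (xP k).1.
- by rewrite mulr_gt0// weight_gt0.
- move=> k; rewrite image_set1 eval1 normrM gtr0_norm ?weight_gt0//.
  by rewrite ler_pM2l ?weight_gt0//; exact: (xP k).2.
Qed.

(** Otherwise fewer than [tau] pieces [S l m] cover the index set.  By the choice
    of [A], in each column some piece has infinitely many values at some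
    coordinate; a piece and a coordinate common to infinitely many columns carry
    an infinite dispersed set, against [compact_no_dispersed_sequence]. *)
Lemma dispersed_space_CG_ge (A : set (omega_power kappa)) (L : Type)
    (K : L -> set W) :
    (forall (I : Type) (C : I -> set (omega_power kappa)),
      card_lt [set: I] [set: tau] -> (forall i, compact (C i)) ->
      ~ (A `<=` \bigcup_i C i)) ->
    (forall t s, A s -> exists a, c a = t /\ g a = s) ->
    infinite_set [set: L] -> (forall l, compact (K l)) ->
    dense (\bigcup_l K l) ->
  [set: tau] #<= [set: L].
Proof.
move=> noncov cg_onto Linf Kco Kdense; apply: contrapT => tauL.
pose S (l : L) (m : nat) : set G :=
  [set a | exists2 x : dispersed_space, K l x & m.+1%:R^-1 <= `|x (0%N, [set a])|].
have Scov a : exists l m, S l m a.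
  have [||x [/= x0 [l _ Klx]]] := Kdense [set x : dispersed_space | x (0%N, [set a]) != 0].
  - by exists (e_ a); rewrite /mkset unit_vector1 oner_eq0.
  - have n0 : open [set r : R | r != 0] by exact: open_neq.
    exact: (weak_open (@span_eval_continuous _ _ _ dispersed_fun (0%N, [set a])) n0).
  have x0' : 0 < `|(x : dispersed_space) (0%N, [set a])| by rewrite normr_gt0.
  have [m _ /(_ m (leqnn _)) /= mP] := near_infty_natSinv_lt (PosNum x0').
  by exists l, m, x => //; exact: ltW.
(* the values at coordinate [n] of the piece [(l, m)] in the column [t] *)
pose V l m t n : set kappa := [set g a n | a in [set a | S l m a /\ c a = t]].
have [q qP] : exists q : tau -> L * nat * nat, forall t,
    infinite_set (V (q t).1.1 (q t).1.2 t (q t).2).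
  suff /choice[q qP] t : exists q : L * nat * nat, infinite_set (V q.1.1 q.1.2 t q.2).
    by exists q.
  apply: contrapT => /forallNP Vfin.
  apply: (noncov (L * nat)%type (fun p => [set s | forall n, V p.1 p.2 t n (s n)])).
  - apply: card_lt_not_le => /card_le_trans le; apply/tauL/le.
    by apply: card_prod_le2 => //; exact: card_nat_le.
  - move=> [l m]; apply: omega_power_compact => n; apply: contrapT.
    exact: (Vfin (l, m, n)).
  - move=> s As; have [a [ca ga]] := cg_onto t s As.
    have [l [m Sa]] := Scov a; exists (l, m) => // n; exists a => //.
    by rewrite ga.
have LNN : [set: L * nat * nat] #<= [set: L].
  have NL := card_nat_le Linf.
  by apply: card_prod_le2 => //; exact: card_prod_le2.
have LNNinf : infinite_set [set: L * nat * nat].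
  apply: (card_le_infinite Linf); apply/card_leTTP.
  by exists (fun l => (l, 0%N, 0%N)) => l l' [].
(* otherwise [tau] would be covered by [L] many finite sets *)
have [[[l m] n] qinf] : exists q0, infinite_set (q @^-1` [set q0]).
  apply: contrapT => /forallNP qfin; apply: tauL; apply: card_le_trans LNN.
  apply: (@card_le_finite_cover _ _ (fun q0 => q @^-1` [set q0])) => //.
    by move=> q0; apply: contrapT; exact: qfin.
  by move=> t; exists (q t).
have [t0 _] := infinite_setN0 qinf.
have /(card_le_setP t0)[t [tq tI]] := (infiniteP _).1 qinf.
have [v [vI vP]] : exists v : nat -> kappa, injective v /\
    forall k, V l m (t k) n (v k).
  apply: (distinct_representatives (V := fun k => V l m (t k) n)) => k.
  by have := qP (t k); rewrite (tq k I).
have /choice[d dP] k : exists a, [/\ S l m a, c a = t k & g a n = v k].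
  by have [a [Sa ca] ga] := vP k; exists a.
have dI : injective d.
  by move=> i k ik; apply: tI => //; have [_ <- _] := dP i; have [_ <- _] := dP k; rewrite ik.
apply: (@compact_no_dispersed_sequence (K l) n d m.+1%:R^-1 (Kco l) dI).
- move=> _ _ [i _ <-] [k _ <-] ik; have ik' : i <> k by move=> e; rewrite e in ik.
  have [_ -> ->] := dP i; have [_ -> ->] := dP k.
  by split=> [/(tI _ _ I I)|/vI].
- by rewrite invr_gt0 ltr0n.
- by move=> k; have [[x Kx xd] _ _] := dP k; exists x.
Qed.

Lemma dispersed_space_density (G_inf : infinite_set [set: G]) :
  is_density dispersed_space G.
Proof.
have lower (L : Type) (S : set dispersed_space) : dense S -> S #= [set: L] ->
    [set: G] #<= [set: L].
  move=> Sd /card_eqPle[/(card_le_trans _) le _]; apply: le.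
  rewrite -(card_le_eqr (card_setT S)).
  have half0 : 0 < 2^-1 :> R by rewrite invr_gt0.
  apply: (@card_le_rel _ _ (fun a (x : S) => `|e_ a - set_val x| < 2^-1)) => [a|a b x].
    have [||x [ax Sx]] := Sd (ball (e_ a) 2^-1).
    - by exists (e_ a); exact: ballxx.
    - exact: ball_open.
    by exists (SigSub (mem_set Sx)); move: ax; rewrite -ball_normE.
  move=> ax bx; apply: contrapT => ab.
  have := closed_span_le_dist (e_ a) (e_ b) (0%N, [set a]).
  rewrite unit_vector1 [e_ b _]dispersed_fun_out; last by move=> /esym.
  rewrite subr0 normr1 => /le_trans/(_ (ler_distD (set_val x) _ _)).
  rewrite distrC in bx; move=> /le_lt_trans/(_ (ltrD ax bx)).
  by have -> : 2^-1 + 2^-1 = 1 :> R; [field|rewrite ltxx].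
split; last by move=> L [S Sd SL]; exact: lower SL.
pose rcomb (s : seq (rat * G)) : dispersed_space := \sum_(p <- s) ratr p.1 *: e_ p.2.
have rdense : dense (range rcomb).
  move=> V [x Vx] Vop.
  have /nbhs_ballP[e e0 eV] : nbhs x V by exact: open_nbhs_nbhs.
  have e20 : 0 < e / 2 by rewrite divr_gt0.
  have [y [b [l Ey]] xy] := generators_total dispersed_fun_le1 x e20.
  have [s ys] : exists s, `|y - rcomb s| < e / 2.
    elim: l (e / 2) e20 y Ey {xy} => [r r0 y ->|l IH r r0 y].
      by exists [::]; rewrite /rcomb big_nil subrr normr0.
    have r20 : 0 < r / 2 by rewrite divr_gt0.
    move=> [a [_ [z [_ [h _ <-] /(IH _ r20)[s zs] ->]]]].
    have [q] : exists q : rat, ratr q \in `]a - r / 2, a + r / 2[.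
      by apply: rat_in_itvoo; rewrite ltrD2l gtrN.
    rewrite in_itv /= -ltr_distlC => qa.
    exists ((q, h) :: s); rewrite /rcomb big_cons opprD addrACA -scalerBl.
    apply: le_lt_trans (ler_normD _ _) _; rewrite [r]splitr; apply: ler_ltD => //.
    rewrite normrZ -[leRHS]mulr1; apply: ler_pM => //; first exact: ltW.
    exact: unit_vector_norm.
  exists (rcomb s); split; last by exists s.
  apply: eV; rewrite -ball_normE /= -(subrKA y).
  by apply: le_lt_trans (ler_normD _ _) _; rewrite [e]splitr ltrD.
exists (range rcomb) => //; apply/card_eqPle; split.
  apply: card_le_trans (card_image_le _ _) _; apply: card_seq_le => //.
  by apply: card_prod_le2 => //; exact: card_countType_le.
rewrite -(card_le_eqr (card_setT (range rcomb))).
by apply: lower rdense _; exact: card_setT_sym.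
Qed.

End dispersed_space.

(** * Construction of the Banach space *)

Section sufficiency.
Variables (R : realType) (kappa tau delta b : Type).
Hypotheses (kappa_inf : infinite_set [set: kappa])
  (tau_inf : infinite_set [set: tau]) (delta_inf : infinite_set [set: delta]).
Hypotheses (kappa_tau : [set: kappa] #<= [set: tau]) (bP : is_b kappa tau b)
  (b_delta : [set: b] #<= [set: delta]).

(** The labelling of [delta] must reach all of [tau * A], which bounds the number
    of generating compact sets from below, and also [kappa] points with distinct
    columns and distinct first coordinates, which bounds the index of
    K-analyticity from below; constant sequences provide the latter. *)
Lemma banach_space_exists : exists X : completeNormedModType R,
  [/\ is_lK R (weak_space X) kappa, is_CG (weak_space X) tau
    & is_density X delta].
Proof.
have [[A Ab noncov] _] := bP.
have A_delta : [set: A] #<= [set: delta].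
  rewrite (card_le_eql (card_setT A)).
  by apply: card_le_trans b_delta; case/card_eqPle : Ab.
have tau_delta : [set: tau] #<= [set: delta].
  apply: card_le_trans A_delta; apply: contrapT => /card_lt_not_le.
  move=> /(noncov A (fun s => [set set_val s])); apply.
    by move=> s; exact: compact_set1.
  by move=> s As; exists (SigSub (mem_set As)).
have /card_leTTP[j jI] := kappa_tau.
pose Q := [set q : tau * (nat -> kappa) | A q.2 \/ exists i, q = (j i, fun=> i)].
have Q_delta : [set: Q] #<= [set: delta].
  have TA := card_prod_le2 delta_inf tau_delta A_delta.
  apply: card_le_trans (card_sum_le delta_inf TA (card_le_trans kappa_tau tau_delta)).
  apply: (@card_le_rel _ _ (fun (q : Q) u => match u with
    | inl p => set_val q = (p.1, set_val p.2)
    | inr i => set_val q = (j i, fun=> i) end)) => [q|q q' u].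
    have /set_mem[Aq|[i qi]] := valP q; last by exists (inr i).
    by exists (inl ((set_val q).1, SigSub (mem_set Aq))); rewrite -surjective_pairing.
  case: u => [p|i] qp qp'.
    have qq : set_val q = set_val q' by rewrite qp qp'.
    exact: val_inj qq.
  have qq : set_val q = set_val q' by rewrite qp qp'.
  exact: val_inj qq.
have [q0 _] : exists q : Q, True.
  have [i _] := infinite_setN0 kappa_inf.
  have Qi : Q (j i, fun=> i) by right; exists i.
  by exists (SigSub (mem_set Qi)).
have [p pP] : exists p : delta -> tau * (nat -> kappa), forall q, Q q -> exists d, p d = q.
  have /card_leTTP[f fI] := Q_delta.
  have /choice[p pP] d : exists q : Q, forall q', f q' = d -> q' = q.
    have [[q qd]|nq] := pselect (exists q, f q = d).
      by exists q => q' q'd; apply: fI; rewrite q'd.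
    by exists q0 => q' q'd; case: nq; exists q'.
  exists (fun d => set_val (p d)) => q Qq; exists (f (SigSub (mem_set Qq))).
  by rewrite -(pP _ (SigSub (mem_set Qq))).
pose c d := (p d).1; pose g d := (p d).2.
have /choice[d dP] i : exists d, p d = (j i, fun=> i).
  by apply: pP; right; exists i.
have dI : injective d by move=> i i' e; apply: jI; have := dP i; rewrite e dP => -[].
have ddisp : dispersed c g 0 (range d).
  move=> _ _ [i _ <-] [i' _ <-] ii'; have ni : i <> i' by move=> e; rewrite e in ii'.
  by rewrite /c /g !dP /=; split=> // /jI.
exists (dispersed_space R c g); split.
- split; first by split=> //; exact: dispersed_space_lK_le.
  move=> L [Linf [M [[[V Vb VL] _] [phi uphi]]]].
  apply: card_le_trans (usco_weight_ge ddisp Linf Vb VL uphi).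
  apply/card_leTTP; exists (fun i => exist _ (d i) (imageP d I)).
  by move=> i i' [] /dI.
- split; first by split=> //; exact: dispersed_space_CG_le.
  move=> L [Linf [K [Kco Kd]]].
  apply: (dispersed_space_CG_ge noncov _ Linf Kco Kd) => t s As.
  by have [|d' d'P] := pP (t, s); [left|exists d'; rewrite /c /g d'P].
- exact: dispersed_space_density.
Qed.

End sufficiency.

Theorem theorem4 (R : realType) (kappa tau delta : Type)
    (kappa_inf : infinite_set [set: kappa])
    (tau_inf : infinite_set [set: tau])
    (delta_inf : infinite_set [set: delta]) :
  (([set: kappa] #<= [set: tau] /\
    exists2 d : Type, is_d kappa d & [set: tau] #<= [set: d]) /\
   (exists2 b : Type, is_b kappa tau b & [set: b] #<= [set: delta]))
  <->
  (exists X : completeNormedModType R,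
    [/\ is_lK R (weak_space X) kappa,
        is_CG (weak_space X) tau
      & is_density X delta]).
Proof.
split=> [[[kt _] [b bP bd]]|[X [XlK XCG Xd]]].
  exact: (banach_space_exists R kappa_inf tau_inf delta_inf kt bP bd).
split; first split.
- exact: lK_le_CG XlK XCG.
- exact: CG_le_d kappa_inf XlK XCG.
- exact: b_le_density kappa_inf delta_inf XlK XCG Xd.
Qed.
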